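(* Let $q\geq 3$ be a fixed integer and fix $\lambda\in(\lambda_s,\lambda_S)$. For each $n$, let $\beta=\beta_n>0$ be defined by $\lambda/n=1-e^{-\beta/n}$, and consider the Swendsen--Wang dynamics for the $q$-state mean-field Potts model on $n$ vertices at inverse temperature $\beta$. Then there exists $c=c(\lambda,q)>0$ such that for all sufficiently large $n$, the mixing time satisfies $t_{\textsc{mix}}\geq \exp(cn)$.
   Context: The mean-field $q$-state Potts model on $n$ vertices with parameter $\beta$ is the probability measure on $\{1,\dots,q\}^n$ given by $\mu(\sigma)\propto \exp\big(\tfrac{\beta}{n}\sum_{1\le i<j\le n}\mathbf 1\{\sigma_i=\sigma_j\}\big)$. For $q>2$ define $\lambda_s=\min_{z\geq 0}\{z+\frac{qz}{e^z-1}\}$ and $\lambda_S=q$ (one has $\lambda_s<\lambda_S$); in the $\beta$-parametrization these are the critical values $\beta_s,\beta_S$. Swendsen--Wang dynamics with $p=1-e^{-\beta/n}=\lambda/n$ is the Markov chain on $\{1,\dots,q\}^n$ which from $\sigma$ moves as follows: (1) letting $V_i=\{x:\sigma_x=i\}$, independently for each $i$ include each edge $xy$ with $x,y\in V_i$ independently with probability $p$ (no edges between different $V_i$), giving an edge configuration $\omega$ on the complete graph; (2) assign to each connected component of $\omega$ (isolated vertices included) an independent uniform color in $\{1,\dots,q\}$, and let $\sigma'_x$ be the color of the component of $x$. For a Markov chain with transition matrix $P$ and stationary distribution $\pi$ on a finite space $\Omega$, $t_{\textsc{mix}}=\inf\{t:\max_{X_0\in\Omega}\|P^t(X_0,\cdot)-\pi\|_{\mathrm{TV}}<1/(2e)\}$,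 where $\|\nu-\pi\|_{\mathrm{TV}}=\sup_{A\subset\Omega}|\nu(A)-\pi(A)|$. *)

(* Defs.v *)
From HB Require Import structures.
From mathcomp Require Import all_boot.
From Stdlib Require Import Reals.

Set Implicit Arguments.
Unset Strict Implicit.
Unset Printing Implicit Defensive.

Definition config (n q : nat) := {ffun 'I_n -> 'I_q}.

(* Edge configurations on the complete graph: only pairs (x,y) with x < y
   are genuine edges; other entries are forced to be false by the weights. *)
Definition edges (n : nat) := {ffun 'I_n * 'I_n -> bool}.

Definition rsum (T : finType) (F : T -> R) : R := \big[Rplus/R0]_(x : T) F x.
Definition rmax (T : finType) (F : T -> R) : R := \big[Rmax/R0]_(x : T) F x.
Definition rmeas (T : finType) (nu : T -> R) (A : {set T}) : R :=
  \big[Rplus/R0]_(x in A) nu x.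

(* Step (1) of Swendsen--Wang: probability of edge configuration w given sigma,
   edges inside colour classes kept independently with probability p. *)
Definition edge_weight (n q : nat) (p : R) (s : config n q) (w : edges n) : R :=
  \big[Rmult/R1]_(e : 'I_n * 'I_n)
    (if (e.1 < e.2)%N && (s e.1 == s e.2)
     then (if w e then p else (1 - p)%R)
     else (if w e then R0 else R1)).

Definition adj (n : nat) (w : edges n) : rel 'I_n := fun x y => w (x, y) || w (y, x).

(* Step (2): each connected component gets an independent uniform colour;
   probability of obtaining s' from w. *)
Definition color_weight (n q : nat) (w : edges n) (s' : config n q) : R :=
  if [forall x, forall y, connect (adj w) x y ==> (s' x == s' y)]
  then pow (Rinv (INR q)) (n_comp (adj w) (predT : {pred 'I_n}))
  else R0.

Definition SW (n q : nat) (p : R) (s s' : config n q) : R :=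
  rsum (fun w : edges n => (edge_weight p s w * color_weight w s')%R).

Definition agree (n q : nat) (s : config n q) : nat :=
  #|[set e : 'I_n * 'I_n | (e.1 < e.2)%N && (s e.1 == s e.2)]|.

Definition potts_w (n q : nat) (beta : R) (s : config n q) : R :=
  exp (beta / INR n * INR (agree s)).
Definition potts (n q : nat) (beta : R) (s : config n q) : R :=
  (potts_w beta s / rsum (potts_w (n:=n) (q:=q) beta))%R.

Fixpoint Pt (T : finType) (P : T -> T -> R) (t : nat) : T -> T -> R :=
  match t with
  | O => fun x y => if x == y then R1 else R0
  | S t' => fun x y => rsum (fun z => (Pt P t' x z * P z y)%R)
  end.

Definition tv (T : finType) (nu pi : T -> R) : R :=
  rmax (fun A : {set T} => Rabs (rmeas nu A - rmeas pi A)).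

Definition dist_t (T : finType) (P : T -> T -> R) (pi : T -> R) (t : nat) : R :=
  rmax (fun x0 : T => tv (Pt P t x0) pi).

(* t belongs to the set whose infimum is t_mix. *)
Definition is_mixed (T : finType) (P : T -> T -> R) (pi : T -> R) (t : nat) : Prop :=
  (dist_t P pi t < Rinv (2 * exp 1))%R.

(* f(z) = z + q z/(e^z - 1), extended continuously by f(0) = q. *)
Definition fs (q : nat) (z : R) : R :=
  if Req_EM_T z 0 then INR q else (z + INR q * z / (exp z - 1))%R.

Definition is_lambda_s (q : nat) (l : R) : Prop :=
  (forall z, 0 <= z -> l <= fs q z)%R /\ (exists z, 0 <= z /\ fs q z = l)%R.

(* beta_n defined by lambda/n = 1 - exp(-beta/n). *)
Definition beta_of (n : nat) (lam : R) : R := (- INR n * ln (1 - lam / INR n))%R.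

(* Main.v *)
(** The chain has two disjoint wells that it leaves with exponentially small
    probability from every one of their states: the disordered well, where all
    colour densities are at most [1/q + eps], and the ordered well, where one
    density is at least [G + eps] and the others are at most [1/q + eps]. Being
    mixed would force the laws started in the two wells to agree, so nothing
    needs to be known about the Potts measure itself.

    Random graphs enter only through the law of the cluster of a vertex. In the
    graph on [m + 1] vertices the cluster of a given vertex has [j + 1] vertices
    with probability [C(m,j) kappa(j+1) (1-p)^((j+1)(m-j))], where
    [kappa k] is the probability that the graph on [k] vertices is connected and
    does not depend on [m]. Since these numbers sum to 1 for every [m], comparing
    two values of [m] bounds them exponentially: [m] is enlarged for subcritical
    graphs and reduced for clusters below the giant component. Removing the
    cluster of one vertex after the other turns this into bounds for expectations
    of products over clusters, such as the exponential moments of the number of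
    vertices of a colour after a step. *)
From Stdlib Require Import Reals.
Require Import Defs.
From mathcomp Require Import all_boot all_order all_algebra.
From mathcomp Require Import Rstruct ring lra.

Set Implicit Arguments.
Unset Strict Implicit.
Unset Printing Implicit Defensive.
Import Order.TTheory GRing.Theory Num.Theory.

Local Open Scope ring_scope.

Bind Scope ring_scope with R.
Arguments exp _%_ring_scope.

(** * Product measures and clusters *)

Section ProductMeasure.
Variables (F : realFieldType) (E : finType) (p : E -> F).
Implicit Types (w : {ffun E -> bool}) (f g : {ffun E -> bool} -> F) (A : {set E}).

(** The parameter depends on the coordinate, so that pairs which cannot be edges receive parameter
    0. *)
Definition bern_weight w : F := \prod_e (if w e then p e else 1 - p e).
Definition bern_E f : F := \sum_w bern_weight w * f w.

Lemma bern_E1 : bern_E (fun=> 1) = 1.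
Proof.
rewrite /bern_E; under eq_bigr => w _ do rewrite mulr1.
rewrite -(bigA_distr_bigA (fun e (b : bool) => if b then p e else 1 - p e)).
by apply: big1 => e _; rewrite big_bool /= addrC subrK.
Qed.

Lemma eq_bern_E f g : f =1 g -> bern_E f = bern_E g.
Proof. by move=> fg; apply: eq_bigr => w _; rewrite fg. Qed.

Lemma bern_EZ (c : F) f : bern_E (fun w => c * f w) = c * bern_E f.
Proof. by rewrite /bern_E mulr_sumr; apply: eq_bigr => w _; rewrite mulrCA. Qed.

Lemma bern_E_sum (I : finType) (P : pred I) (G : I -> {ffun E -> bool} -> F) :
  bern_E (fun w => \sum_(i | P i) G i w) = \sum_(i | P i) bern_E (G i).
Proof.
by rewrite /bern_E exchange_big /=; apply: eq_bigr => w _; rewrite mulr_sumr.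
Qed.

(* Exchanging two independent samples on the coordinates in [A] preserves
   their joint law. *)
Lemma bern_E_indep A f g :
    (forall w w', {in A, w =1 w'} -> f w = f w') ->
    (forall w w', (forall e, e \notin A -> w e = w' e) -> g w = g w') ->
  bern_E (fun w => f w * g w) = bern_E f * bern_E g.
Proof.
move=> fA gA.
pose mix w w' : {ffun E -> bool} := [ffun e => if e \in A then w e else w' e].
pose h (u : {ffun E -> bool} * {ffun E -> bool}) := (mix u.1 u.2, mix u.2 u.1).
have hK : involutive h.
  have mixK w w' : mix (mix w w') (mix w' w) = w.
    by apply/ffunP=> e; rewrite !ffunE; case: (e \in A).
  by case=> w w'; rewrite /h /= !mixK.
have weight2 w w' : bern_weight w * bern_weight w' =
    bern_weight (mix w w') * bern_weight (mix w' w).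
  rewrite /bern_weight -!big_split; apply: eq_bigr => e _ /=.
  by rewrite !ffunE; case: (e \in A) => //; rewrite mulrC.
(* The factor 1 is the total mass of a second sample, which turns both sides into sums over pairs of
   samples. *)
rewrite -[LHS]mulr1 -[X in _ * X]bern_E1 /bern_E !big_distrlr /= !pair_big /=.
rewrite [RHS](reindex_inj (inv_inj hK)) /=; apply: eq_bigr => -[w w'] _ /=.
rewrite mulr1 mulrAC weight2 mulrACA.
have -> : f (mix w w') = f w by apply: fA => e eA; rewrite ffunE eA.
have -> : g (mix w' w) = g w by apply: gA => e /negPf eA; rewrite ffunE eA.
by ring.
Qed.

Lemma bern_E_none A :
  bern_E (fun w : {ffun E -> bool} => [forall e in A, ~~ w e]%:R) = \prod_(e in A) (1 - p e).
Proof.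
pose G e (b : bool) := (if b then p e else 1 - p e) * (if e \in A then (~~ b)%:R else 1).
have -> : bern_E (fun w : {ffun E -> bool} => [forall e in A, ~~ w e]%:R) =
    \sum_(w : {ffun E -> bool}) \prod_e G e (w e).
  apply: eq_bigr => w _; rewrite big_split /=; congr (_ * _).
  rewrite -big_mkcond /=; case: forallP => wA.
    by rewrite big1 // => e eA; have /implyP -> := wA e.
  have /forall_inPn[e eA] : ~~ [forall e in A, ~~ w e] by apply/negP => /forallP.
  by rewrite negbK => we; apply/esym/eqP/prodf_eq0; exists e; rewrite ?we.
rewrite -bigA_distr_bigA [RHS]big_mkcond /=; apply: eq_bigr => e _.
by rewrite big_bool /G /=; case: ifP => _; ring.
Qed.

Hypothesis p01 : forall e, 0 <= p e <= 1.

Lemma bern_weight_ge0 w : 0 <= bern_weight w.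
Proof.
apply: prodr_ge0 => e _; have /andP[p0 p1] := p01 e.
by case: ifP => //; rewrite subr_ge0.
Qed.

Lemma ler_bern_E f g : (forall w, f w <= g w) -> bern_E f <= bern_E g.
Proof.
by move=> fg; apply: ler_sum => w _; apply: ler_wpM2l (fg w); exact: bern_weight_ge0.
Qed.

Lemma bern_E_ge0 f : (forall w, 0 <= f w) -> 0 <= bern_E f.
Proof. by move=> f0; apply: sumr_ge0 => w _; apply: mulr_ge0 (f0 w); exact: bern_weight_ge0. Qed.

End ProductMeasure.

(** * Clusters of a graph restricted to a vertex set *)

Section Clusters.
Variable n : nat.
Implicit Types (w : edges n) (x y z : 'I_n) (S T U A : {set 'I_n}).

(** The vertex set is a parameter because clusters are removed one by one and the graph on the rest
    is studied. *)
Definition adj_in U w : rel 'I_n := fun x y => [&& x \in U, y \in U & adj w x y].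
Definition cluster U w x : {set 'I_n} := [set y | connect (adj_in U w) x y].
Definition clusters U w : {set {set 'I_n}} := [set cluster U w x | x in U].
(** Both orientations occur because a configuration has a value at every ordered pair and [adj]
    reads both. *)
Definition separated S T w := [forall e in setX S T :|: setX T S, ~~ w e].

Lemma adj_in_sym U w : symmetric (adj_in U w).
Proof. by move=> x y; rewrite /adj_in /adj orbC andbCA. Qed.

Lemma connect_adj_in_sym U w : connect_sym (adj_in U w).
Proof. exact/sym_connect_sym/adj_in_sym. Qed.

Lemma adj_sym w : symmetric (adj w).
Proof. by move=> x y; rewrite /adj orbC. Qed.

Lemma mem_cluster U w x : x \in cluster U w x.
Proof. by rewrite inE connect0. Qed.

Lemma cluster_sub U w x : x \in U -> cluster U w x \subset U.
Proof.
move=> xU; apply/subsetP => y; rewrite inE => /connectP[r].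
elim: r x xU => [|z r IHr] x xU /=; first by move=> _ ->.
by case/andP=> /and3P[_ zU _]; apply: IHr.
Qed.

Lemma eq_cluster U w x y : y \in cluster U w x -> cluster U w y = cluster U w x.
Proof.
rewrite inE => xy; apply/setP=> z; rewrite !inE.
by rewrite (same_connect (connect_adj_in_sym U w) xy).
Qed.

Lemma cluster_dep U w w' x : {in setX U U, w =1 w'} -> cluster U w x = cluster U w' x.
Proof.
move=> ww'; apply/setP=> y; rewrite !inE; apply: eq_connect => u v.
rewrite /adj_in; case uU: (u \in U) => //=; case vU: (v \in U) => //=.
by rewrite /adj !ww' // in_setX ?uU ?vU.
Qed.

Lemma separatedP S T w :
  reflect {in S & T, forall y z, ~~ adj w y z} (separated S T w).
Proof.
apply: (iffP forall_inP) => [sep y z yS zT|sep [y z]].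
  by rewrite negb_or !sep // !inE yS zT ?orbT.
rewrite !inE /= => /orP[] /andP[yS zT].
  by have := sep y z yS zT; rewrite negb_or => /andP[].
by have := sep z y zT yS; rewrite negb_or => /andP[].
Qed.

Lemma separatedC S T w : separated S T w = separated T S w.
Proof. by rewrite /separated setUC. Qed.

(** A path from [A] inside [U] has no edge to cross into [U :\: A], so it stays in [A]. *)
Lemma cluster_restrict A U w y :
  A \subset U -> separated A (U :\: A) w -> y \in A -> cluster U w y = cluster A w y.
Proof.
move=> AU /separatedP sep yA; apply/setP=> z; rewrite !inE.
apply/idP/idP; last first.
  apply: connect_sub => u v /and3P[uA vA uv]; apply: connect1.
  by rewrite /adj_in !(subsetP AU).
case/connectP=> r; elim: r y yA => [|v r IHr] y yA /=; first by move=> _ ->.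
case/andP=> /and3P[_ vU yv] rP rz.
have vA : v \in A.
  by apply: contraLR yv => vA; apply: sep => //; rewrite inE vA.
by apply: connect_trans (IHr v vA rP rz); apply: connect1; apply/and3P; split.
Qed.

(** Splits the event into connectedness of [S] and absence of edges leaving [S], which depend on
    disjoint sets of pairs. *)
Lemma cluster_eqE S U w x : S \subset U -> x \in S ->
  (cluster U w x == S) = (cluster S w x == S) && separated S (U :\: S) w.
Proof.
move=> SU xS; apply/eqP/andP => [clS|[/eqP clS sep]]; last by rewrite (cluster_restrict SU).
have sep : separated S (U :\: S) w.
  apply/separatedP => y z yS; rewrite inE => /andP[zS zU].
  apply: contra zS => yz; rewrite -clS inE.
  have : y \in cluster U w x by rewrite clS.
  rewrite inE => /connect_trans; apply; apply: connect1.
  by rewrite /adj_in (subsetP SU) ?zU.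
by split=> //; rewrite -(cluster_restrict SU) ?clS.
Qed.

Lemma clusters_split S U w x : S \subset U -> x \in S ->
    cluster S w x = S -> separated S (U :\: S) w ->
  clusters U w = S |: clusters (U :\: S) w /\ S \notin clusters (U :\: S) w.
Proof.
move=> SU xS clS sep; set T := U :\: S.
have TU : T \subset U by apply: subsetDl.
have UT : U :\: T = S by rewrite setDDr setDv set0U; apply/setIidPr.
have clU y : y \in S -> cluster U w y = S.
  by move=> yS; rewrite (cluster_restrict SU) // -[RHS]clS; apply: eq_cluster; rewrite clS.
have clT y : y \in T -> cluster U w y = cluster T w y.
  by apply: cluster_restrict; rewrite // UT separatedC.
split; last first.
  apply/negP => /imsetP[y yT eqS].
  have /(subsetP (cluster_sub w yT)) : x \in cluster T w y by rewrite -eqS.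
  by rewrite inE xS.
apply/setP=> C; rewrite in_setU1; apply/imsetP/orP => [[y yU ->]|[/eqP->|/imsetP[y yT ->]]].
- have [yS|yS] := boolP (y \in S); first by left; rewrite clU.
  by right; rewrite clT ?inE ?yS //; apply: imset_f; rewrite inE yS.
- by exists x; rewrite ?clU //; apply: (subsetP SU).
by exists y; rewrite ?clT //; apply: (subsetP TU).
Qed.

Lemma clusters_dep U w w' : {in setX U U, w =1 w'} -> clusters U w = clusters U w'.
Proof. by move=> ww'; apply: eq_imset => x; apply: cluster_dep. Qed.

End Clusters.

(** * Removing the cluster of a vertex *)

Section ClusterRecursion.
Variables (F : realFieldType) (n : nat) (p : 'I_n * 'I_n -> F).
Implicit Types (g : {set 'I_n} -> F) (S U : {set 'I_n}).

Definition cluster_mean U g : F :=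
  bern_E p (fun w : edges n => \prod_(C in clusters U w) g C).

(** For [x] in [S] this is the probability that the graph on [S] is connected. *)
Definition conn_prob x S : F := bern_E p (fun w : edges n => (cluster S w x == S)%:R).

Definition sep_prob S T : F := \prod_(e in setX S T :|: setX T S) (1 - p e).

Lemma cluster_mean0 g : cluster_mean set0 g = 1.
Proof.
rewrite -[RHS](@bern_E1 F _ p); apply: eq_bern_E => w.
by rewrite /clusters imset0 big_set0.
Qed.

(** Sum over the value [S] of the cluster of [x]. The pairs inside [S], those between [S] and
    [U :\: S], and those inside [U :\: S] are independent, which gives the two probabilities and the
    mean over the rest. *)
Lemma cluster_mean_rec U g x : x \in U ->
  cluster_mean U g = \sum_(S : {set 'I_n} | (S \subset U) && (x \in S))
    conn_prob x S * sep_prob S (U :\: S) * g S * cluster_mean (U :\: S) g.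
Proof.
move=> xU.
have -> : cluster_mean U g = bern_E p (fun w : edges n =>
    \sum_(S : {set 'I_n} | (S \subset U) && (x \in S))
      g S * ((cluster S w x == S)%:R * ((separated S (U :\: S) w)%:R *
        \prod_(C in clusters (U :\: S) w) g C))).
  apply: eq_bern_E => w.
  rewrite [RHS](bigD1 (cluster U w x)) /=; last first.
    by apply/andP; split; [exact: cluster_sub | exact: mem_cluster].
  rewrite [X in _ + X]big1 ?addr0.
    have sub := cluster_sub w xU; have xC := mem_cluster U w x.
    have := eqxx (cluster U w x); rewrite {1}cluster_eqE // => /andP[/eqP cl sep].
    have [-> notin] := clusters_split sub xC cl sep.
    by rewrite big_setU1 //= cl eqxx sep !mul1r.
  move=> S /andP[/andP[SU xS] neqS]; have := cluster_eqE w SU xS; rewrite eq_sym (negPf neqS).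
  by case: (_ == S); case: (separated _ _ _); rewrite //= ?mul0r ?mulr0 ?mul0r ?mulr0.
rewrite bern_E_sum.
apply: eq_bigr => S /andP[SU xS]; rewrite bern_EZ.
rewrite (@bern_E_indep _ _ p (setX S S)); first last.
- move=> w w' ww'; congr ((nat_of_bool _)%:R * _).
    rewrite /separated; apply: eq_forallb_in => e; rewrite !inE => eST; rewrite ww' // !inE.
    by apply: contraTN eST => /andP[-> ->].
  rewrite (clusters_dep (w' := w')) // => e; rewrite !inE => /andP[/andP[e1 _] _].
  by rewrite ww' // !inE negb_and e1.
- by move=> w w' ww'; rewrite (cluster_dep _ ww').
rewrite (@bern_E_indep _ _ p (setX S (U :\: S) :|: setX (U :\: S) S)); first last.
- move=> w w' ww'; rewrite (clusters_dep (w' := w')) // => e; rewrite !inE.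
  by case/andP=> /andP[/negPf e1 _] /andP[/negPf e2 _]; rewrite ww' // !inE e1 e2 /= !andbF.
- move=> w w' ww'; congr ((nat_of_bool _)%:R); rewrite /separated; apply: eq_forallb_in => e eA; rewrite ww' //.
by rewrite bern_E_none -/(sep_prob S (U :\: S)) -/(conn_prob x S) -/(cluster_mean (U :\: S) g); ring.
Qed.

End ClusterRecursion.

(** * The law of the cluster of a vertex *)

(** Deleting [x] maps these sets onto the subsets of [A :\ x], of which ['C(#|A|.-1, j)] have [j]
    elements. *)
Lemma sum_by_card (F : realFieldType) n (A : {set 'I_n}) x (phi : nat -> F) : x \in A ->
  \sum_(S : {set 'I_n} | (S \subset A) && (x \in S)) phi #|S| =
  \sum_(j < #|A|) phi j.+1 *+ 'C(#|A|.-1, j).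
Proof.
move=> xA; rewrite (reindex_onto (fun B => x |: B) (fun S => S :\ x)); last first.
  by move=> S /andP[_ xS]; rewrite setD1K.
have condE (B : {set 'I_n}) : (x |: B \subset A) && (x \in x |: B) && ((x |: B) :\ x == B) =
    (B \subset A :\ x).
  rewrite setU11 andbT subUset sub1set xA subsetD1 /=; congr (_ && _).
  apply/eqP/idP => [<-|xB]; first by rewrite setD11.
  by rewrite setU1K.
rewrite (eq_bigl _ _ condE).
have cardAx : #|A :\ x| = #|A|.-1 by rewrite (cardsD1 x A) xA.
have ltB (B : {set 'I_n}) : B \subset A :\ x -> (#|B| < #|A|)%N.
  by move/subset_leq_card; rewrite (cardsD1 x A) xA.
have A0 : (0 < #|A|)%N by apply/card_gt0P; exists x.
(* Cardinality as an index below [#|A|]; the default never occurs, since every [B] in the sum is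
   smaller than [A]. *)
pose card' (B : {set 'I_n}) : 'I_#|A| := odflt (Ordinal A0) (insub #|B|).
rewrite (partition_big card' predT) //=; apply: eq_bigr => j _.
have -> : \sum_(B : {set 'I_n} | (B \subset A :\ x) && (card' B == j)) phi #|x |: B| =
    \sum_(B in [set B : {set 'I_n} | (B \subset A :\ x) && (#|B| == j)]) phi j.+1.
  rewrite (eq_bigl [in [set B : {set 'I_n} | (B \subset A :\ x) && (#|B| == j)]]); last first.
    move=> B; rewrite inE /=; case BA: (B \subset _) => //=.
    by rewrite /card' insubT ?ltB //= => ?; rewrite -val_eqE.
  apply: eq_bigr => B; rewrite inE => /andP[BA /eqP <-].
  by rewrite cardsU1; move: BA; rewrite subsetD1 => /andP[_ ->].
by rewrite sumr_const cards_draws cardAx.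
Qed.

Section ColouredGraph.
Variables (F : realFieldType) (p : F) (n : nat) (C : eqType) (s : 'I_n -> C).
Hypothesis p01 : 0 <= p <= 1.
Implicit Types (S T U : {set 'I_n}) (c : C).

(** Parameter 0 off the increasing monochromatic pairs turns the product measure on all ordered
    pairs into the edge law of the dynamics. Colours lie in any [eqType], so a constant colouring
    gives the plain random graph. *)
Definition edge_prob (e : 'I_n * 'I_n) : F :=
  if (e.1 < e.2)%N && (s e.1 == s e.2) then p else 0.

Definition colour_class c : {set 'I_n} := [set x | s x == c].

Lemma edge_prob01 e : 0 <= edge_prob e <= 1.
Proof. by rewrite /edge_prob; case: ifP => // _; rewrite lexx ler01. Qed.

(** Only vertices of [T] with colour [c] can be joined to [S]; of the two orientations of such a
    pair one has factor [1 - p] and the other factor 1. *)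
Lemma sep_prob_class S T c : S \subset colour_class c -> [disjoint S & T] ->
  sep_prob edge_prob S T = (1 - p) ^+ (#|S| * #|T :&: colour_class c|).
Proof.
move=> SV dST; rewrite /sep_prob (eq_bigl [in [predU setX S T & setX T S]]); last first.
  by move=> e; rewrite !inE.
rewrite bigU /=; last first.
  rewrite -setI_eq0; apply/eqP/setP => -[y z]; rewrite !inE /=; apply/negP.
  by case/andP=> /andP[yS _] /andP[yT _]; have := disjointFr dST yS; rewrite yT.
pose swap (e : 'I_n * 'I_n) := (e.2, e.1).
have swapK : involutive swap by case.
rewrite [X in _ * X](reindex_inj (inv_inj swapK)) /=.
rewrite [X in _ * X](eq_bigl [in setX S T]); last by case=> y z; rewrite !inE andbC.
rewrite -big_split /=.
rewrite (eq_bigr (fun e => if e.2 \in colour_class c then 1 - p else 1)); last first.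
  case=> y z; rewrite !inE => /andP[yS zT] /=.
  have /eqP sy : s y == c by have := subsetP SV _ yS; rewrite inE.
  have neq : y != z by apply: contraTneq zT => <-; rewrite (disjointFr dST yS).
  rewrite /edge_prob /= sy [s z == c]eq_sym.
  case: (ltngtP y z) => [yz|zy|/val_inj yz]; last by rewrite yz eqxx in neq.
    by case: (c == _); rewrite /= ?subr0 ?mulr1.
  by case: (c == _); rewrite /= ?subr0 ?mul1r.
rewrite (eq_bigl (fun e => (e.1 \in S) && (e.2 \in T))); last by move=> e; rewrite inE.
rewrite -(pair_big [in S] [in T] (fun _ z => if z \in colour_class c then 1 - p else 1)) /=.
rewrite (eq_bigr (fun=> (1 - p) ^+ #|T :&: colour_class c|)).
  by rewrite prodr_const -exprM mulnC.
move=> y _; rewrite -prodr_const -big_mkcondr /=.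
by apply: eq_bigl => z; rewrite [in RHS]inE.
Qed.

Lemma bern_weight_mono (w : edges n) x y :
  bern_weight edge_prob w != 0 -> adj w x y -> s x = s y.
Proof.
move=> w0; have nz e : w e -> s e.1 = s e.2.
  move=> we; apply/eqP; apply: contraNT w0 => se.
  by apply/prodf_eq0; exists e => //; rewrite we /edge_prob (negPf se) andbF.
by case/orP=> /nz.
Qed.

(** In configurations of nonzero weight every edge joins equal colours, so a connected set has a
    single colour. *)
Lemma conn_prob_mono x S : x \in S -> ~~ (S \subset colour_class (s x)) ->
  conn_prob edge_prob x S = 0.
Proof.
move=> xS /subsetPn[y yS]; rewrite inE => syx.
apply: big1 => w _; have [->|w0] := eqVneq (bern_weight edge_prob w) 0.
  by rewrite mul0r.
case: eqP => [clS|]; last by rewrite mulr0.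
move: yS; rewrite -clS inE => /connectP[r].
suff sr z : path (adj_in S w) z r -> s (last z r) = s z.
  by move=> /sr srx ylast; rewrite ylast srx eqxx in syx.
elim: r z => //= u r IHr z /andP[/and3P[_ _ zu] /IHr->].
by rewrite (bern_weight_mono w0 zu).
Qed.

Lemma cluster_mean1 U : cluster_mean edge_prob U (fun=> 1) = 1.
Proof.
rewrite -[RHS](@bern_E1 F _ edge_prob); apply: eq_bern_E => w.
by rewrite big1.
Qed.

Lemma conn_prob_ge0 x S : 0 <= conn_prob edge_prob x S.
Proof. by apply: bern_E_ge0 => [|w]; [exact: edge_prob01 | rewrite ler0n]. Qed.

(** Total probability for the cluster of [x]: the recursion with [g] equal to 1. *)
Lemma conn_prob_sum S x c : S \subset colour_class c -> x \in S ->
  \sum_(S' : {set 'I_n} | (S' \subset S) && (x \in S'))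
    conn_prob edge_prob x S' * (1 - p) ^+ (#|S'| * (#|S| - #|S'|)) = 1.
Proof.
move=> SV xS; rewrite -[RHS](cluster_mean1 S) (cluster_mean_rec _ _ xS).
apply: eq_bigr => S' /andP[S'S xS']; rewrite cluster_mean1 !mulr1.
rewrite (@sep_prob_class _ _ c) ?(subset_trans S'S) //; last first.
  by rewrite disjoint_sym disjoints_subset setDE subsetIr.
congr (_ * _ ^+ (_ * _)); rewrite (setIidPl _) ?cardsDS //.
by apply: subset_trans SV; apply: subsetDl.
Qed.

End ColouredGraph.

(** * Probability of connectedness and the law of the cluster size *)

Section ConnectedProbability.
Variables (F : realFieldType) (p : F).
Hypothesis p01 : 0 <= p <= 1.

(** The colouring is constant; the value at 0 is a default, as clusters are nonempty. *)
Definition kappa (k : nat) : F :=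
  if k is k'.+1 then conn_prob (edge_prob p (fun _ : 'I_k'.+1 => tt)) ord0 setT else 0.

Lemma kappa_ge0 k : 0 <= kappa k.
Proof. by case: k => //= k; apply: conn_prob_ge0. Qed.

(** By [conn_prob_sum] the probability for [S] is determined by those for its proper subsets,
    through an equation in which only cardinalities enter once smaller sets are known. Strong
    induction then identifies the values in the two graphs. *)
Lemma conn_probE n (C : eqType) (s : 'I_n -> C) (S : {set 'I_n}) x c :
  S \subset colour_class s c -> x \in S -> conn_prob (edge_prob p s) x S = kappa #|S|.
Proof.
move: {2}#|S| (leqnn #|S|) => k; elim/ltn_ind: k => k IHk in n C s S x c *.
(* The cutoff [i < m] drops the term of the full set, so that the induction hypothesis covers all
   the others. *)
pose phi m i := (if (i < m)%N then kappa i else 0) * (1 - p) ^+ (i * (m - i)).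
have step n' (C' : eqType) (s' : 'I_n' -> C') (S' : {set 'I_n'}) x' c' :
    S' \subset colour_class s' c' -> x' \in S' -> (#|S'| <= k)%N ->
    conn_prob (edge_prob p s') x' S' =
      1 - \sum_(j < #|S'|) phi #|S'| j.+1 *+ 'C(#|S'|.-1, j).
  move=> S'V xS' leS'k; rewrite -(sum_by_card _ xS') -[X in X - _](conn_prob_sum p S'V xS').
  rewrite (bigD1 S') ?subxx //= [in X in _ - X](bigD1 S') ?subxx //=.
  have -> : phi #|S'| #|S'| = 0 by rewrite /phi ltnn mul0r.
  rewrite add0r subnn muln0 expr0 mulr1.
  rewrite [X in _ = _ + X - _](eq_bigr (fun T : {set 'I_n'} => phi #|S'| #|T|)) ?addrK //.
  move=> T /andP[/andP[TS' xT] neqT]; rewrite /phi.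
  have ltT : (#|T| < #|S'|)%N by rewrite proper_card // properEneq neqT.
  rewrite ltT; congr (_ * _).
  by apply: (IHk #|T|) (subset_trans TS' S'V) xT; rewrite ?(leq_trans ltT).
move=> leSk SV xS; rewrite (step _ _ _ _ _ _ SV xS leSk).
have: (0 < #|S|)%N by apply/card_gt0P; exists x.
case E: #|S| => [//|k'] _ /=.
have TV : [set: 'I_k'.+1] \subset colour_class (fun=> tt) tt.
  by apply/subsetP => z; rewrite !inE.
rewrite (step _ _ _ _ _ _ TV) ?inE // ?cardsT ?card_ord //.
by rewrite -E.
Qed.

Definition cluster_law (m j : nat) : F :=
  'C(m, j)%:R * kappa j.+1 * (1 - p) ^+ (j.+1 * (m - j)).

Lemma cluster_law_ge0 m j : 0 <= cluster_law m j.
Proof.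
have /andP[_ p1] := p01; rewrite /cluster_law mulr_ge0 ?exprn_ge0 ?subr_ge0 //.
by rewrite mulr_ge0 ?kappa_ge0.
Qed.

Lemma cluster_law_sum m : \sum_(j < m.+1) cluster_law m j = 1.
Proof.
pose s := fun _ : 'I_m.+1 => tt.
have TV : [set: 'I_m.+1] \subset colour_class s tt by apply/subsetP => z; rewrite !inE.
rewrite -(conn_prob_sum p TV (in_setT ord0)).
rewrite (eq_bigr (fun S : {set 'I_m.+1} =>
    kappa #|S| * (1 - p) ^+ (#|S| * (m.+1 - #|S|)))); last first.
  move=> S /andP[SV xS]; rewrite (conn_probE (subset_trans SV TV) xS).
  by rewrite cardsT card_ord.
rewrite (sum_by_card (fun i => kappa i * (1 - p) ^+ (i * (m.+1 - i))) (in_setT ord0)).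
rewrite cardsT card_ord; apply: eq_bigr => j _.
by rewrite /cluster_law subSS -mulrA mulr_natl.
Qed.

(** Clusters are monochromatic, so the sum runs only over subsets of the class of [x], and only
    absent edges within that class cost a factor. *)
Lemma cluster_mean_class n (C : eqType) (s : 'I_n -> C) (U : {set 'I_n}) x g : x \in U ->
  let V := U :&: colour_class s (s x) in
  cluster_mean (edge_prob p s) U g =
  \sum_(S : {set 'I_n} | (S \subset V) && (x \in S))
    kappa #|S| * (1 - p) ^+ (#|S| * (#|V| - #|S|)) * g S *
    cluster_mean (edge_prob p s) (U :\: S) g.
Proof.
move=> xU V; rewrite (cluster_mean_rec _ _ xU).
rewrite (bigID (fun S : {set 'I_n} => S \subset colour_class s (s x))) /=.
rewrite [X in _ + X]big1 ?addr0; last first.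
  by move=> S /andP[/andP[SU xS] SV]; rewrite conn_prob_mono // !mul0r.
apply: eq_big => [S|S /andP[/andP[SU xS] SV]].
  by rewrite subsetI andbAC.
rewrite (conn_probE SV xS) (sep_prob_class _ SV); last first.
  by rewrite disjoint_sym disjoints_subset setDE subsetIr.
congr (_ * _ ^+ (_ * _) * _ * _); rewrite setIDAC cardsDS //.
by rewrite subsetI SU.
Qed.

Lemma cluster_law_sets n (V : {set 'I_n}) x (gam : nat -> F) : x \in V ->
  \sum_(S : {set 'I_n} | (S \subset V) && (x \in S))
    kappa #|S| * (1 - p) ^+ (#|S| * (#|V| - #|S|)) * gam #|S| =
  \sum_(j < #|V|) cluster_law #|V|.-1 j * gam j.+1.
Proof.
move=> xV; rewrite (sum_by_card (fun i => kappa i * (1 - p) ^+ (i * (#|V| - i)) * gam i) xV).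
have: (0 < #|V|)%N by apply/card_gt0P; exists x.
case E: #|V| => [//|k] _ /=; apply: eq_bigr => j _.
by rewrite /cluster_law subSS -[LHS]mulr_natl !mulrA.
Qed.

(** The unknown [kappa j.+1] is common to both sides, so the ratio of the laws for consecutive sizes
    is explicit. All comparisons of sizes rest on this identity. *)
Lemma cluster_law_succ N j : (j <= N)%N ->
  cluster_law N j * (1 - p) ^+ j.+1 * N.+1%:R = cluster_law N.+1 j * (N.+1 - j)%:R.
Proof.
move=> jN; have := mul_bin_down N.+1 j => /(congr1 (fun k => k%:R : F)).
rewrite !natrM /= subSn // => H; rewrite /cluster_law subSn // [in RHS]mulnS exprD.
rewrite -[LHS]mulrA !mulrA; move: H; set a := 'C(N, j)%:R; set b := 'C(N.+1, j)%:R.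
set u := (1 - p) ^+ _; set v := (1 - p) ^+ _ => H.
transitivity (N.+1%:R * a * kappa j.+1 * u * v); first by ring.
by rewrite H; ring.
Qed.

End ConnectedProbability.

(** * Recolouring the clusters *)

Section Recolouring.
Variables (n q : nat).
Hypothesis q0 : (0 < q)%N.
Implicit Types (w : edges n) (s : config n q).

Lemma color_weightE w s : color_weight w s =
  if [forall x, forall y, connect (adj w) x y ==> (s x == s y)]
  then (q%:R^-1 : R) ^+ #|roots (adj w)| else 0.
Proof.
rewrite /color_weight; case: ifP => // _.
rewrite RpowE INRE; congr (_ ^+ _).
by apply: eq_card => x; rewrite !inE andbT.
Qed.

Lemma color_weight_ge0 w s : 0 <= color_weight w s :> R.
Proof. by rewrite color_weightE; case: ifP => // _; rewrite exprn_ge0 // invr_ge0 ler0n. Qed.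

Lemma connect_adj_in_setT w : connect (adj_in setT w) =2 connect (adj w).
Proof. by apply: eq_connect => x y; rewrite /adj_in !inE. Qed.

Lemma connect_adj_sym w : connect_sym (adj w).
Proof. exact/sym_connect_sym/adj_sym. Qed.

(** Given the edges, the colours of the clusters are independent and uniform, so a test function
    that is a product over vertices integrates to a product over clusters. *)
Lemma sum_color_weight w (u : 'I_n -> 'I_q -> R) :
  \sum_s color_weight w s * \prod_x u x (s x) =
  \prod_(C in clusters setT w) (q%:R^-1 * \sum_c \prod_(x in C) u x c).
Proof.
set e := adj w; have sym := connect_adj_sym w.
have memC x y : (y \in cluster setT w x) = (fingraph.root e y == fingraph.root e x).
  by rewrite inE connect_adj_in_setT -(root_connect sym) eq_sym.
have clE : clusters setT w = [set cluster setT w r | r in roots e].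
  apply/setP=> C; apply/imsetP/imsetP => -[x xP ->]; last by exists x.
  exists (fingraph.root e x); first exact: roots_root.
  by apply/esym/eq_cluster; rewrite memC root_root.
rewrite clE big_imset /=; last first.
  move=> r1 r2 /eqP r1P /eqP r2P eq12.
  by have := mem_cluster setT w r1; rewrite eq12 memC r1P r2P => /eqP.
pose c0 : 'I_q := Ordinal q0.
rewrite [RHS](eq_bigr (fun r => \sum_c q%:R^-1 * \prod_(x in cluster setT w r) u x c));
  last by move=> r _; rewrite mulr_sumr.
rewrite (big_distr_big c0) /=.
pose good s := [forall x, forall y, connect e x y ==> (s x == s y)].
(* [spread] extends colours chosen at the roots to their clusters and [restr] goes back, with the
   default [c0] off the roots. They match the colourings constant on clusters with the terms of the
   expanded product. *)
pose spread (f : config n q) : config n q := [ffun x => f (fingraph.root e x)].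
pose restr (f : config n q) : config n q := [ffun x => if roots e x then f x else c0].
rewrite (bigID good) /= [X in _ + X]big1 ?addr0; last first.
  by move=> s /negPf bad; rewrite color_weightE -/(good s) bad mul0r.
rewrite (reindex_onto spread restr) /=; last first.
  move=> s /forallP sgood; apply/ffunP=> x; rewrite !ffunE roots_root //.
  have /forallP/(_ x)/implyP/(_ _)/eqP -> // := sgood (fingraph.root e x).
  by rewrite sym connect_root.
have goodS f : good (spread f).
  apply/forallP=> x; apply/forallP=> y; apply/implyP=> xy.
  by rewrite !ffunE; move: xy; rewrite -(root_connect sym) => /eqP ->.
apply: eq_big => [f|f _].
  rewrite goodS /=; apply/eqP/pffun_onP => [<-|[fP _]].
    split=> //; apply/subsetP=> x; rewrite inE ffunE unfold_in.
    by rewrite -[x \in _]/(roots e x); case: (roots e x) => //; rewrite eqxx.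
  apply/ffunP=> x; rewrite !ffunE; case: ifP => [/eqP-> //|rx].
  by apply/esym/eqP; apply: contraFT rx => fx; apply: (subsetP fP).
rewrite color_weightE -/(good _) goodS -prodr_const.
rewrite [X in _ * X](partition_big (fingraph.root e) (fun r => r \in roots e)) /=; last first.
  by move=> x _; apply: roots_root.
rewrite -big_split /=; apply: eq_bigr => r /eqP rP; congr (_ * _).
apply: eq_big => x; first by rewrite memC rP.
by move=> /eqP xr; rewrite ffunE xr.
Qed.

Lemma sum_color_weight1 w : \sum_(s : config n q) color_weight w s = 1 :> R.
Proof.
transitivity (\sum_(s : config n q) color_weight w s * \prod_(x : 'I_n) (1 : R)).
  by apply: eq_bigr => s _; rewrite big1 ?mulr1.
rewrite (sum_color_weight w (fun=> fun=> 1)); apply: big1 => C _.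
rewrite [X in _ * X](eq_bigr (fun=> 1)) => [|c _]; last by rewrite big1.
by rewrite sumr_const card_ord -mulr_natl mulr1 mulVf // pnatr_eq0 -lt0n.
Qed.

Variable p : R.
Hypothesis p01 : 0 <= p <= 1.

Lemma edge_weightE s w : edge_weight p s w = bern_weight (edge_prob p s) w.
Proof.
apply: eq_bigr => e _; rewrite /edge_prob.
by case: ifP => _; case: (w e); rewrite ?subr0.
Qed.

Lemma SW_event s (D : pred (config n q)) :
  \sum_(s' | D s') SW p s s' =
  bern_E (edge_prob p s) (fun w : edges n => \sum_(s' | D s') color_weight w s').
Proof.
rewrite bern_E_sum; apply: eq_bigr => s' _.
by apply: eq_bigr => w _; rewrite -edge_weightE.
Qed.

Lemma SW_ge0 s s' : 0 <= SW p s s'.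
Proof.
apply: sumr_ge0 => w _; rewrite edge_weightE mulr_ge0 ?color_weight_ge0 //.
exact/bern_weight_ge0/edge_prob01.
Qed.

Lemma SW_sum1 s : \sum_s' SW p s s' = 1.
Proof.
rewrite (SW_event s predT) -[RHS](@bern_E1 _ _ (edge_prob p s)).
by apply: eq_bern_E => w; apply: sum_color_weight1.
Qed.

End Recolouring.

(** * Exponential bounds *)

Lemma exp0 : exp 0 = 1.
Proof. exact: exp_0. Qed.

Lemma expM (x y : R) : exp x * exp y = exp (x + y).
Proof. by apply/esym/exp_plus. Qed.

Lemma exp_congr (x y : R) : x = y -> exp x = exp y.
Proof. by move->. Qed.

Lemma exp_gt0 (x : R) : 0 < exp x. Proof. by apply/RltP/exp_pos. Qed.

Lemma exp_ge0 (x : R) : 0 <= exp x. Proof. exact/ltW/exp_gt0. Qed.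

Lemma exp_ge1Dx (x : R) : 1 + x <= exp x.
Proof. by apply/RleP/exp_ineq1_le. Qed.

Lemma ler_exp (x y : R) : x <= y -> exp x <= exp y.
Proof.
move=> xy; rewrite -[y](subrK x) -expM ler_peMl ?exp_ge0 //.
by apply: le_trans (exp_ge1Dx _); rewrite lerDl subr_ge0.
Qed.

Lemma exp_le1 (x : R) : x <= 0 -> exp x <= 1.
Proof. by move=> x0; rewrite -[leRHS]exp0 ler_exp. Qed.

Lemma exp_sqr_le (x : R) : 0 <= x -> x ^+ 2 <= 4 * exp x.
Proof.
move=> x0; have -> : exp x = exp (x / 2) * exp (x / 2) by rewrite expM; apply: exp_congr; field.
have h := exp_ge1Dx (x / 2); have : (1 + x / 2) * (1 + x / 2) <= exp (x / 2) * exp (x / 2).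
  by apply: ler_pM => //; lra.
by nra.
Qed.

Lemma exp_taylor1 (u : R) : exp u <= 1 + u + u ^+ 2 * exp `|u|.
Proof.
have E0 := exp_gt0 u; have E1 := exp_ge1Dx u.
have E2 : exp u * (1 - u) <= 1.
  rewrite -[leRHS]exp0 -(subrr u) -expM ler_wpM2l ?exp_ge0 //.
  exact: exp_ge1Dx.
have [u0|u0] := leP 0 u.
  by rewrite (ger0_norm u0); nra.
have E3 : 1 <= exp `|u| by rewrite -[leLHS]exp0 ler_exp.
have : exp u <= 1 + u + u ^+ 2 by nra.
have := sqr_ge0 u; nra.
Qed.

(** Here [exp (- x)] is at most [1 / (1 + x)], which lies below [1 - x / 2] on the unit interval. *)
Lemma exp_le_linear (x : R) : 0 <= x <= 1 -> exp (- x) <= 1 - x / 2.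
Proof.
move=> /andP[x0 x1]; have := exp_ge1Dx x; have := exp_gt0 (- x).
have : exp x * exp (- x) = 1 by rewrite expM subrr exp0.
by nra.
Qed.

(** Convexity: the tangent at [- (r * z)] lies below [exp] at 0 and at [- z], and the two
    inequalities are averaged with weights [1 - r] and [r]. *)
Lemma exp_chord (z r : R) : 0 <= r <= 1 -> exp (- (r * z)) <= 1 - r * (1 - exp (- z)).
Proof.
move=> /andP[r0 r1]; have E0 := exp_gt0 (- (r * z)).
have h1 : exp (- (r * z)) * (1 + r * z) <= 1.
  rewrite -[leRHS]exp0 -(addNr (r * z)) -expM ler_wpM2l ?exp_ge0 //.
  exact: exp_ge1Dx.
have h2 : exp (- (r * z)) * (1 - z + r * z) <= exp (- z).
  have -> : exp (- z) = exp (- (r * z)) * exp (- z + r * z) by rewrite expM; apply: exp_congr; ring.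
  by rewrite ler_wpM2l ?exp_ge0 //; have := exp_ge1Dx (- z + r * z); rewrite addrA.
have : r * (exp (- (r * z)) * (1 - z + r * z)) <= r * exp (- z) by rewrite ler_wpM2l.
have : (1 - r) * (exp (- (r * z)) * (1 + r * z)) <= (1 - r) * 1.
  by rewrite ler_wpM2l // subr_ge0.
by nra.
Qed.

(* Mean over a uniform colour of [exp (t k)] if the colour is a given one,
   of [1] otherwise. *)
Definition colour_mgf (q : nat) (t : R) (k : nat) : R :=
  q%:R^-1 * (exp (t * k%:R) + (q%:R - 1)).

Lemma colour_mgf_ge0 q t k : (0 < q)%N -> 0 <= colour_mgf q t k.
Proof.
move=> q0; rewrite /colour_mgf mulr_ge0 ?invr_ge0 // addr_ge0 ?exp_ge0 //.
by rewrite subr_ge0 ler1n.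
Qed.

(** After the mean is factored out, a centred variable with two values remains; its first-order
    terms cancel and [exp_taylor1] bounds the rest. *)
Lemma colour_mgf_le q t k : (0 < q)%N ->
  colour_mgf q t k <=
  exp (t / q%:R * k%:R) * (1 + t ^+ 2 * (k%:R ^+ 2 * exp (`|t| * k%:R))).
Proof.
move=> q0; have qR : 1 <= q%:R :> R by rewrite ler1n.
set r : R := q%:R^-1; set y := t * k%:R.
have r0 : 0 < r by rewrite invr_gt0; lra.
have r1 : r <= 1 by rewrite invf_le1; lra.
have rq : r * q%:R = 1 by rewrite mulVf //; lra.
have -> : `|t| * k%:R = `|y| by rewrite normrM (ger0_norm (ler0n _ k)).
have -> : t ^+ 2 * (k%:R ^+ 2 * exp `|y|) = y ^+ 2 * exp `|y| by rewrite /y; ring.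
have -> : colour_mgf q t k = exp (r * y) * (r * exp ((1 - r) * y) + (1 - r) * exp (- r * y)).
  have e1 : exp y = exp (r * y) * exp ((1 - r) * y) by rewrite expM; apply: exp_congr; ring.
  have e2 : exp (r * y) * exp (- r * y) = 1 by rewrite expM -exp0; apply: exp_congr; ring.
  rewrite /colour_mgf -/r -/y e1; set A := exp (r * y); set B := exp _; set D := exp _.
  transitivity (r * (A * B) + (r * q%:R - r)); first by ring.
  transitivity (r * (A * B) + (1 - r) * (A * D)); last by ring.
  by rewrite rq e2; ring.
have -> : t / q%:R * k%:R = r * y by rewrite /y -/r; ring.
rewrite ler_wpM2l ?exp_ge0 //.
have bnd v : -1 <= v <= 1 -> exp (v * y) <= 1 + v * y + y ^+ 2 * exp `|y|.
  move=> v1; apply: le_trans (exp_taylor1 _) _; rewrite lerD2l.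
  have vn : `|v| <= 1 by rewrite ler_norml.
  apply: ler_pM; rewrite ?exp_ge0 ?sqr_ge0 //.
    by rewrite exprMn ler_piMl ?sqr_ge0 //; nra.
  by apply: ler_exp; rewrite normrM ler_piMl.
have b1 : exp ((1 - r) * y) <= 1 + (1 - r) * y + y ^+ 2 * exp `|y| by apply: bnd; lra.
have b2 : exp (- r * y) <= 1 + - r * y + y ^+ 2 * exp `|y| by apply: bnd; lra.
have := ler_wpM2l (ltW r0) b1.
have r1' : 0 <= 1 - r by lra.
have := ler_wpM2l r1' b2.
set X := y ^+ 2 * _; nra.
Qed.

Lemma truncn_half (x : R) : 2 <= x -> exists J : nat, x / 2 <= J%:R <= x.
Proof.
move=> x2; exists (Num.truncn x); have x0 : 0 <= x by lra.
have := truncn_itv x0; rewrite -natr1 => /andP[-> ]; lra.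
Qed.

(** * Comparing cluster laws of different sizes *)

Section SizeChange.
Variable p : R.
Hypothesis p01 : 0 <= p <= 1.

Lemma cluster_law_gt m j : (m < j)%N -> cluster_law p m j = 0.
Proof. by move=> mj; rewrite /cluster_law bin_small // !mul0r. Qed.

Lemma cluster_law_psum m k : \sum_(j < k) cluster_law p m j <= 1.
Proof.
apply: (@le_trans _ _ (\sum_(j < k + m.+1) cluster_law p m j)).
  rewrite big_split_ord /= lerDl; apply: sumr_ge0 => j _; exact: cluster_law_ge0.
rewrite addnC big_split_ord /= cluster_law_sum // big1 ?addr0 // => j _.
by rewrite cluster_law_gt //= addSn ltnS leq_addr.
Qed.

(* A change of [m] multiplies the law by a factor that is exponential in the
   cluster size: enlarging [m] does so in the subcritical regime. *)
Lemma cluster_law_up (n : R) (lam nu : R) m J j :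
    0 < n -> 0 < nu -> 1 <= (1 - p) * exp (lam / n) ->
    (m + J)%:R <= nu * n -> (j <= m)%N ->
  cluster_law p m j <=
    exp (J%:R / n * (j.+1%:R * lam - j%:R / nu)) * cluster_law p (m + J) j.
Proof.
move=> n0 nu0 plam mJ jm; elim: J mJ => [|J IHJ] mJ.
  by rewrite !mul0r exp0 mul1r addn0.
have mJ' : (m + J)%:R <= nu * n by apply: le_trans mJ; rewrite ler_nat leq_add2l.
apply: le_trans (IHJ mJ') _; rewrite addnS.
set N := (m + J)%N in mJ mJ' *; have jN : (j <= N)%N by rewrite (leq_trans jm) ?leq_addr.
have succE := cluster_law_succ p jN.
set x := J%:R / n * _.
have -> : J.+1%:R / n * (j.+1%:R * lam - j%:R / nu) =
    x + (j.+1%:R * (lam / n) - j%:R / (nu * n)).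
  by rewrite /x -[J.+1%:R]natr1; field; lra.
rewrite -expM -mulrA ler_wpM2l ?exp_ge0 //.
have N0 : 0 < N.+1%:R :> R by rewrite ltr0n.
set a := cluster_law p N j in succE *; set b := cluster_law p N.+1 j in succE *.
have b0 : 0 <= b by apply: cluster_law_ge0.
have a0 : 0 <= a by apply: cluster_law_ge0.
set v := exp (lam / n) in plam *.
have pow1 : 1 <= (1 - p) ^+ j.+1 * v ^+ j.+1 by rewrite -exprMn exprn_ege1.
have vE : exp (j.+1%:R * (lam / n)) = v ^+ j.+1.
  rewrite /v; elim: (j.+1) => [|k IHk]; first by rewrite mul0r exp0 expr0.
  by rewrite exprS -IHk expM; apply: exp_congr; rewrite -[k.+1%:R]natr1; ring.
have jE : 1 - j%:R / N.+1%:R <= exp (- (j%:R / (nu * n))).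
  apply: le_trans (exp_ge1Dx _); rewrite lerD2l lerN2.
  rewrite ler_wpM2l ?ler0n // lef_pV2 ?posrE ?mulr_gt0 //.
  by move: mJ; rewrite addnS.
have v0 : 0 <= v ^+ j.+1 by rewrite exprn_ge0 ?exp_ge0.
(* The explicit ratio of consecutive laws. The power of [1 - p] is compensated by [v], and the last
   factor is bounded by [jE]. *)
have aE : a * (1 - p) ^+ j.+1 = b * (1 - j%:R / N.+1%:R).
  apply: (mulIf (lt0r_neq0 N0)); rewrite succE natrB ?(leqW jN) //.
  by field; lra.
apply: (@le_trans _ _ (a * ((1 - p) ^+ j.+1 * v ^+ j.+1))).
  by rewrite ler_peMr.
rewrite [leLHS]mulrA aE -expM vE.
have -> : forall E, v ^+ j.+1 * E * b = b * E * v ^+ j.+1 by move=> E; ring.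
by rewrite ler_wpM2r // ler_wpM2l.
Qed.

(** The last hypothesis says that a cluster of size [j.+1] lies below the giant component of a graph
    on [g] vertices. With [d * n] further vertices the ratio of the laws falls below
    [1 - d / n * j.+1]. *)
Lemma cluster_law_down_step (n lam g d : R) N j :
    0 < n -> 0 < d -> 1 - p <= exp (- (lam / n)) -> 0 < g -> g + d * n <= N.+1%:R ->
    N.+1%:R <= n -> exp (- (lam * j.+1%:R / n)) <= 1 - j.+1%:R / g ->
  cluster_law p N.+1 j <= exp (- (d / n * j.+1%:R)) * cluster_law p N j.
Proof.
move=> n0 d0 plam g0 gN Nn big_j.
have /andP[p0 p1] := p01.
set k : R := j.+1%:R in big_j *.
have k0 : 0 < k by rewrite ltr0n.
have kg : k < g.
  have := lt_le_trans (exp_gt0 _) big_j; rewrite subr_gt0 ltr_pdivrMr //.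
  by rewrite mul1r.
set M : R := N.+1%:R in gN Nn *.
have dn0 : 0 < d * n by apply: mulr_gt0.
have jN : (j <= N)%N by rewrite -ltnS -(ltr_nat R) -/k -/M; lra.
have := cluster_law_succ p jN; rewrite natrB ?leqW // -/M.
set a := cluster_law p N j; set b := cluster_law p N.+1 j.
have a0 : 0 <= a by apply: cluster_law_ge0.
have b0 : 0 <= b by apply: cluster_law_ge0.
have jk : j%:R = k - 1 :> R by rewrite /k -natr1 addrK.
rewrite jk => succE.
have powE : (1 - p) ^+ j.+1 <= 1 - k / g.
  apply: le_trans big_j; have -> : lam * k / n = k * (lam / n) by ring.
  rewrite /k; elim: (j.+1) => [|i IHi]; first by rewrite mul0r oppr0 exp0 expr0.
  have -> : - (i.+1%:R * (lam / n)) = - (lam / n) + - (i%:R * (lam / n)).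
    by rewrite -[i.+1%:R]natr1; ring.
  by rewrite exprS -expM ler_pM ?exprn_ge0 // subr_ge0.
have Mk : 0 < M - k by lra.
have step : b * (M - k) <= a * (1 - k / g) * M.
  apply: (@le_trans _ _ (b * (M - (k - 1)))); first by rewrite ler_wpM2l //; lra.
  by rewrite -succE ler_wpM2r ?ler_wpM2l ?ler0n.
have fac : (1 - k / g) * M <= (1 - d / n * k) * (M - k).
  rewrite -subr_ge0.
  have -> : (1 - d / n * k) * (M - k) - (1 - k / g) * M =
      k * ((M - g) / g - d * (M - k) / n) by field; lra.
  apply: mulr_ge0; [exact: ltW | rewrite subr_ge0].
  apply: (@le_trans _ _ (d * n / n)).
    by rewrite ler_pM2r ?invr_gt0 // ler_wpM2l //; lra.
  rewrite ler_pdivlMr //; apply: (@le_trans _ _ (d * n)); last by lra.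
  have -> : d * n / n * g = d * g by field; lra.
  have gn : g <= n by lra.
  by rewrite ler_pM2l.
have step2 : b * (M - k) <= a * (1 - d / n * k) * (M - k).
  by apply: (le_trans step); rewrite -[leLHS]mulrA -[leRHS]mulrA ler_wpM2l.
move: step2; rewrite ler_pM2r // => step2; apply: (le_trans step2).
rewrite mulrC ler_wpM2r //; have := exp_ge1Dx (- (d / n * k)); lra.
Qed.

Lemma cluster_law_down (n lam g d : R) N J j :
    0 < n -> 0 < d -> 1 - p <= exp (- (lam / n)) -> 0 < g -> g + d * n <= N%:R ->
    (N + J)%:R <= n -> exp (- (lam * j.+1%:R / n)) <= 1 - j.+1%:R / g ->
  cluster_law p (N + J) j <= exp (- (d / n * j.+1%:R * J%:R)) * cluster_law p N j.
Proof.
move=> n0 d0 plam g0 gN Nn big_j; elim: J Nn => [|J IHJ] Nn.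
  by rewrite mulr0 oppr0 exp0 mul1r addn0.
rewrite addnS in Nn *.
apply: (le_trans (cluster_law_down_step n0 d0 plam g0 _ Nn big_j)).
  by apply: le_trans gN _; rewrite ler_nat leqW ?leq_addr.
have -> : - (d / n * j.+1%:R * J.+1%:R) =
    - (d / n * j.+1%:R) + - (d / n * j.+1%:R * J%:R).
  by rewrite -[J.+1%:R]natr1; ring.
rewrite -expM -[leRHS]mulrA ler_wpM2l ?exp_ge0 //; apply: IHJ.
by apply: le_trans Nn; rewrite ler_nat.
Qed.

End SizeChange.

(** For [y = lam / n], [exp (y / (1 - y))] is at least [1 / (1 - y)], and the threshold on [n] is
    exactly what gives [y / (1 - y) <= lam' / n]. *)
Lemma edge_param_bounds (lam lam' n : R) :
    0 < lam -> lam < lam' -> lam * lam' / (lam' - lam) <= n ->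
  [/\ 0 < n, 0 <= lam / n <= 1, 1 - lam / n <= exp (- (lam / n)) &
      1 <= (1 - lam / n) * exp (lam' / n)].
Proof.
move=> lam0 lt; rewrite ler_pdivrMr ?subr_gt0 // => nK.
have n0 : lam < n.
  by rewrite -(ltr_pM2r (x := lam' - lam)) ?subr_gt0 //; nra.
have np : 0 < n by lra.
have y1 : lam / n < 1 by rewrite ltr_pdivrMr // mul1r.
have y0 : 0 < lam / n by apply: divr_gt0.
split=> //; first by apply/andP; split; apply: ltW.
  by have := exp_ge1Dx (- (lam / n)).
set y := lam / n in y0 y1 *.
have h : y / (1 - y) <= lam' / n.
  rewrite ler_pdivrMr ?subr_gt0 // /y.
  have -> : lam' / n * (1 - lam / n) = (lam' * (n - lam)) / n / n by field; lra.
  rewrite -mulrA [leRHS]mulrA ler_pM2r ?invr_gt0 //.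
  rewrite ler_pdivlMr //; lra.
apply: (@le_trans _ _ ((1 - y) * (1 + y / (1 - y)))).
  have -> // : (1 - y) * (1 + y / (1 - y)) = 1 by field; lra.
rewrite ler_wpM2l ?subr_ge0 ?(ltW y1) //.
by apply: le_trans (exp_ge1Dx _) (ler_exp h).
Qed.

(** The size [m] is enlarged by about [tau * n] vertices while the graph stays subcritical. The
    factor from [cluster_law_up] then decays exponentially in the cluster size. *)
Lemma subcritical_tail (lam rho : R) : 0 < lam -> 0 < rho -> lam * rho < 1 ->
  exists A c K : R, [/\ 0 < A, 0 < c & forall n : nat, K <= n%:R ->
    forall m : nat, m%:R <= rho * n%:R -> exists M : nat, forall j : nat, (j <= m)%N ->
    cluster_law (lam / n%:R) m j <=
      A * exp (- (c * j.+1%:R)) * cluster_law (lam / n%:R) M j].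
Proof.
move=> lam0 rho0 sub.
set d := 1 - lam * rho; have d0 : 0 < d by rewrite subr_gt0.
(* Enlarging [rho] to [nu] and [lam] to [lam'] each costs at most a quarter of the gap [d], so that
   [nu * lam' <= 1 - d / 2]. *)
set tau := d / (4 * (lam + 1)); set nu := rho + tau; set lam' := lam + d / (4 * nu).
have tau0 : 0 < tau by rewrite divr_gt0 //; lra.
have nu0 : 0 < nu by apply: addr_gt0.
have lam'0 : lam < lam' by rewrite ltrDl divr_gt0 //; lra.
have ltau : lam * tau <= d / 4.
  have -> : lam * tau = (lam / (lam + 1)) * (d / 4) by rewrite /tau; field; lra.
  have : lam / (lam + 1) <= 1 by rewrite ler_pdivrMr; lra.
  by nra.
have nulam' : nu * lam' <= 1 - d / 2.
  have -> : nu * lam' = lam * rho + lam * tau + d / 4 by rewrite /lam' /nu; field; rewrite -/nu; lra.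
  by rewrite /d in ltau *; lra.
have gap : 0 < 1 / nu - lam'.
  rewrite subr_gt0 ltr_pdivlMr // mulrC; lra.
(* The prefactor pays for replacing [j] by [j.+1] in the exponent; the rate uses that [J / n] is at
   least [tau / 2]. *)
exists (exp (tau / nu)), (tau / 2 * (1 / nu - lam')), (lam * lam' / (lam' - lam) + 2 / tau).
split; [exact: exp_gt0 | by apply: mulr_gt0 => //; apply: divr_gt0 |].
move=> n nK m mrho.
have K1 : 0 <= lam * lam' / (lam' - lam).
  by apply: divr_ge0; [apply: mulr_ge0; lra | lra].
have K2 : 0 < 2 / tau by apply: divr_gt0.
have [np p01 plam plam'] : [/\ 0 < n%:R :> R, 0 <= lam / n%:R <= 1,
    1 - lam / n%:R <= exp (- (lam / n%:R)) & 1 <= (1 - lam / n%:R) * exp (lam' / n%:R)].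
  by apply: edge_param_bounds => //; lra.
have [J /andP[J1 J2]] : exists J : nat, tau * n%:R / 2 <= J%:R <= tau * n%:R.
  apply: truncn_half; rewrite mulrC -ler_pdivrMr //; lra.
exists (m + J)%N => j jm.
have up := cluster_law_up p01 np nu0 plam' _ jm.
apply: le_trans (up J _) _; first by rewrite natrD /nu mulrDl lerD.
rewrite ler_wpM2r ?cluster_law_ge0 // expM ler_exp //.
set x := J%:R / n%:R.
have x1 : tau / 2 <= x by rewrite ler_pdivlMr // mulrAC.
have x2 : x <= tau by rewrite ler_pdivrMr.
have -> : x * (j.+1%:R * lam' - j%:R / nu) =
    x * (1 / nu) - x * ((1 / nu - lam') * j.+1%:R).
  by rewrite -[j.+1%:R]natr1; field; lra.
have nv : 0 < 1 / nu by apply: divr_gt0.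
have j0 : 0 <= j.+1%:R :> R by rewrite ler0n.
have h1 : x * (1 / nu) <= tau / nu by rewrite mul1r ler_wpM2r // invr_ge0 ltW.
by rewrite lerD // lerN2 -[leLHS]mulrA ler_wpM2r // mulr_ge0 // ltW.
Qed.

(** Removal of a single cluster: its exponential moment is paid for by the mean [t / q] and a
    quadratic correction per vertex. This is the inductive step of [subcritical_mgf]. *)
Lemma subcritical_mgf_step (lam rho : R) : 0 < lam -> 0 < rho -> lam * rho < 1 ->
  exists D t0 K : R, [/\ 0 < D, 0 < t0 & forall n : nat, K <= n%:R ->
    forall (m q : nat) (t : R), (0 < q)%N -> m%:R <= rho * n%:R -> `|t| <= t0 ->
    \sum_(j < m.+1) cluster_law (lam / n%:R) m j *
      (colour_mgf q t j.+1 * exp (- ((t / q%:R + D * t ^+ 2) * j.+1%:R))) <= 1].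
Proof.
move=> lam0 rho0 sub; have [A [c [K [A0 c0 tail]]]] := subcritical_tail lam0 rho0 sub.
(* [16 / c ^+ 2] bounds [k ^+ 2 * exp (- (c / 2 * k))]; half of the rate [c] is left to absorb
   [exp (|t| k)]. *)
pose B := A * (16 / c ^+ 2); have B0 : 0 < B by rewrite mulr_gt0 // divr_gt0 // exprn_gt0.
pose t0 := Num.min (c / 2) (1 / (2 * B + 1)).
exists (2 * B), t0, (Num.max K lam); split.
- by apply: mulr_gt0.
- by rewrite lt_min !divr_gt0 //; lra.
move=> n; rewrite ge_max => /andP[nK nlam] m q t q0 mrho tt0.
have np : 0 < n%:R :> R by lra.
have p01 : 0 <= lam / n%:R <= 1.
  by apply/andP; split; [apply: divr_ge0; lra | rewrite ler_pdivrMr // mul1r].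
have [M tailM] := tail n nK m mrho.
have [tc tB] : `|t| <= c / 2 /\ `|t| <= 1 / (2 * B + 1).
  by move: tt0; rewrite le_min => /andP[].
set kap := 2 * B * t ^+ 2.
have kap1 : 0 <= kap <= 1.
  have t2 : t ^+ 2 = `|t| * `|t| by rewrite -expr2 real_normK ?num_real.
  have tn := normr_ge0 t.
  have tb : `|t| * (2 * B + 1) <= 1 by rewrite -ler_pdivlMr //; lra.
  rewrite /kap t2; apply/andP; split; first by apply: mulr_ge0; [lra | exact: mulr_ge0].
  have : `|t| <= 1 by nra.
  by nra.
have kap0 : 0 <= kap by case/andP: kap1.
(* The zeroth-order part keeps the law for [m] and gains [exp (- kap)], since clusters have at least
   one vertex; the second-order part is bounded by the law for [M]. Both laws have mass at most 1,
   and [kap = 2 B t^2] balances the two parts. *)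
pose T j : R := cluster_law (lam / n%:R) m j * exp (- kap) +
  t ^+ 2 * B * cluster_law (lam / n%:R) M j.
apply: (@le_trans _ _ (\sum_(j < m.+1) T j)).
  apply: ler_sum => j _; rewrite /T.
  set k : R := j.+1%:R; have k1 : 1 <= k by rewrite ler1n.
  set L := cluster_law _ m j.
  have L0 : 0 <= L by apply: cluster_law_ge0.
  set LM := cluster_law _ M j in tailM *.
  have LM0 : 0 <= LM by apply: cluster_law_ge0.
  have tailj : L <= A * exp (- (c * k)) * LM by apply: tailM; rewrite -ltnS.
  have E0 := exp_gt0 (- (kap * k)).
  have E1 : exp (- (kap * k)) <= exp (- kap) by apply: ler_exp; rewrite lerN2 ler_peMr.
  have E2 : exp (- (kap * k)) <= 1 by apply: exp_le1; rewrite oppr_le0 mulr_ge0 ?ler0n.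
  set W := k ^+ 2 * exp (`|t| * k).
  have W0 : 0 <= W by rewrite mulr_ge0 ?exp_ge0 ?exprn_ge0 //; lra.
  have step : colour_mgf q t j.+1 * exp (- ((t / q%:R + kap) * k)) <=
      (1 + t ^+ 2 * W) * exp (- (kap * k)).
    apply: le_trans (ler_wpM2r (exp_ge0 _) (colour_mgf_le _ _ q0)) _.
    rewrite -/k -/W mulrAC expM [leLHS]mulrC.
    by have -> : t / q%:R * k + - ((t / q%:R + kap) * k) = - (kap * k) by ring.
  apply: le_trans (ler_wpM2l L0 step) _.
  have main : L * W <= B * LM.
    have ex : W * exp (- (c * k)) <= 16 / c ^+ 2.
      rewrite /W -mulrA expM.
      have h1 : exp (`|t| * k + - (c * k)) <= exp (- (c / 2 * k)).
        have : `|t| * k <= c / 2 * k by rewrite ler_wpM2r ?ler0n.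
        by move=> ?; apply: ler_exp; lra.
      have h2 : (c / 2 * k) ^+ 2 <= 4 * exp (c / 2 * k) by apply: exp_sqr_le; rewrite mulr_ge0 ?ler0n // divr_ge0 // ltW.
      have h3 : exp (c / 2 * k) * exp (- (c / 2 * k)) = 1.
        by rewrite expM -exp0; apply: exp_congr; ring.
      have h4 := exp_gt0 (- (c / 2 * k)).
      apply: (@le_trans _ _ (k ^+ 2 * exp (- (c / 2 * k)))).
        by rewrite ler_wpM2l ?sqr_ge0.
      rewrite ler_pdivlMr ?exprn_gt0 //.
      have : (c / 2 * k) ^+ 2 * exp (- (c / 2 * k)) <=
          4 * (exp (c / 2 * k) * exp (- (c / 2 * k))) by rewrite mulrA ler_pM2r.
      rewrite h3 mulr1; set e := exp _.
      have -> : (c / 2 * k) ^+ 2 * e = k ^+ 2 * e * c ^+ 2 / 4 by field.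
      by lra.
    apply: (@le_trans _ _ (A * exp (- (c * k)) * LM * W)); first by rewrite ler_wpM2r.
    have -> : A * exp (- (c * k)) * LM * W = A * LM * (W * exp (- (c * k))) by ring.
    have -> : B * LM = A * LM * (16 / c ^+ 2) by rewrite /B; ring.
    by rewrite ler_wpM2l // mulr_ge0 // ltW.
  have t2 := sqr_ge0 t.
  have -> : L * ((1 + t ^+ 2 * W) * exp (- (kap * k))) =
    L * exp (- (kap * k)) + t ^+ 2 * (L * W * exp (- (kap * k))) by ring.
  rewrite lerD ?ler_wpM2l // -[leRHS]mulrA ler_wpM2l //.
  apply: le_trans main; rewrite ler_piMr // mulr_ge0 //.
rewrite /T big_split /= -mulr_suml -mulr_sumr cluster_law_sum // mul1r.
have := exp_le_linear kap1.
have : t ^+ 2 * B * \sum_(j < m.+1) cluster_law (lam / n%:R) M j <= t ^+ 2 * B * 1.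
  by rewrite ler_wpM2l ?cluster_law_psum // mulr_ge0 ?sqr_ge0 // ltW.
rewrite /kap; lra.
Qed.

(** * Expectations of products over clusters *)

Section ClusterMeanBounds.
Variables (F : realFieldType) (p : F) (n : nat) (C : eqType) (s : 'I_n -> C).
Hypothesis p01 : 0 <= p <= 1.
Implicit Types (U : {set 'I_n}) (g : {set 'I_n} -> F).

Lemma clusters_sub U (w : edges n) (S : {set 'I_n}) : S \in clusters U w -> S \subset U.
Proof. by case/imsetP=> x xU ->; apply: cluster_sub. Qed.

Lemma eq_cluster_mean (r : 'I_n * 'I_n -> F) U g g' :
  (forall S : {set 'I_n}, S \subset U -> g S = g' S) -> cluster_mean r U g = cluster_mean r U g'.
Proof.
by move=> gg'; apply: eq_bern_E => w; apply: eq_bigr => S /clusters_sub/gg'.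
Qed.

Lemma ler_cluster_mean U g g' : (forall S : {set 'I_n}, 0 <= g S <= g' S) ->
  cluster_mean (edge_prob p s) U g <= cluster_mean (edge_prob p s) U g'.
Proof.
move=> gg'; apply: ler_bern_E => [|w]; first exact: edge_prob01.
by apply: ler_prod => S _.
Qed.

End ClusterMeanBounds.

Lemma card_class_setD (T : finType) (A V S : {set T}) : S \subset A :&: V ->
  #|(A :\: S) :&: V| = (#|A :&: V| - #|S|)%N.
Proof. by move=> SV; rewrite setIDAC cardsDS. Qed.

(** Induction on [#|U|], removing the cluster of one vertex: the density bound passes to what
    remains, and the sum over the removed cluster is at most 1 by the single step. *)
Lemma subcritical_mgf (lam rho : R) : 0 < lam -> 0 < rho -> lam * rho < 1 ->
  exists D t0 K : R, [/\ 0 < D, 0 < t0 & forall n : nat, K <= n%:R ->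
    forall (C : eqType) (s : 'I_n -> C) (U : {set 'I_n}) (q : nat) (t : R),
    (0 < q)%N -> (forall c, #|U :&: colour_class s c|%:R <= rho * n%:R) -> `|t| <= t0 ->
    cluster_mean (edge_prob (lam / n%:R) s) U (fun S => colour_mgf q t #|S|) <=
    exp ((t / q%:R + D * t ^+ 2) * #|U|%:R)].
Proof.
move=> lam0 rho0 sub; have [D [t0 [K [D0 t00 step]]]] := subcritical_mgf_step lam0 rho0 sub.
exists D, t0, (Num.max K lam); split=> // n; rewrite ge_max => /andP[nK nlam] C s U q t q0.
have np : 0 < n%:R :> R by lra.
have p01 : 0 <= lam / n%:R <= 1.
  by apply/andP; split; [apply: divr_ge0; lra | rewrite ler_pdivrMr // mul1r].
move=> Urho tt0; set a := t / q%:R + D * t ^+ 2.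
move: {2}#|U| (leqnn #|U|) => k; elim: k U Urho => [|k IHk] U Urho Uk.
  move: Uk; rewrite leqn0 cards_eq0 => /eqP ->.
  by rewrite cluster_mean0 cards0 mulr0 exp0.
have [->|/set0Pn[x xU]] := eqVneq U set0; first by rewrite cluster_mean0 cards0 mulr0 exp0.
rewrite (cluster_mean_class _ _ _ xU) /=; set V := U :&: _.
have xV : x \in V by rewrite !inE xU eqxx.
pose gam k' : R := colour_mgf q t k' * exp (- (a * k'%:R)).
have mE := cluster_law_sets (lam / n%:R) gam xV.
apply: (@le_trans _ _ (exp (a * #|U|%:R) * \sum_(j < #|V|) cluster_law (lam / n%:R) #|V|.-1 j * gam j.+1)).
  rewrite -mE mulr_sumr; apply: ler_sum => S /andP[SV xS].
  have SU : S \subset U by apply: subset_trans SV (subsetIl _ _).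
  have S0 : (0 < #|S|)%N by apply/card_gt0P; exists x.
  have IH : cluster_mean (edge_prob (lam / n%:R) s) (U :\: S) (fun S => colour_mgf q t #|S|) <=
      exp (a * #|U :\: S|%:R).
    apply: IHk => [c|].
      apply: le_trans (Urho c); rewrite ler_nat subset_leq_card // setSI //.
      exact: subsetDl.
    by rewrite cardsDS // leq_subLR (leq_trans Uk) // -add1n leq_add2r.
  have -> : exp (a * #|U|%:R) = exp (a * #|U :\: S|%:R) * exp (a * #|S|%:R).
    by rewrite expM cardsDS // natrB ?subset_leq_card //; apply: exp_congr; ring.
  have E : exp (a * #|S|%:R) * exp (- (a * #|S|%:R)) = 1.
    by rewrite expM subrr exp0.
  rewrite /gam; set W := kappa _ _ * _; set h := colour_mgf _ _ _.
  have -> : exp (a * #|U :\: S|%:R) * exp (a * #|S|%:R) * (W * (h * exp (- (a * #|S|%:R)))) =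
    W * h * exp (a * #|U :\: S|%:R) * (exp (a * #|S|%:R) * exp (- (a * #|S|%:R))) by ring.
  rewrite E mulr1 ler_wpM2l // mulr_ge0 ?colour_mgf_ge0 // mulr_ge0 ?kappa_ge0 //.
  by rewrite exprn_ge0 // subr_ge0; case/andP: p01.
have V0 : (0 < #|V|)%N by apply/card_gt0P; exists x.
rewrite ler_piMr ?exp_ge0 //; have := step n nK #|V|.-1 q t q0 _ tt0.
rewrite prednK //; apply; apply: le_trans (Urho (s x)).
by rewrite ler_nat leq_pred.
Qed.

(* A cluster of size [k] is small if it lies below the giant component of a
   graph on [g] vertices with mean degree [lam g / n]. *)
Definition small_cluster (lam n g : R) (k : nat) : bool :=
  exp (- (lam * k%:R / n)) <= 1 - k%:R / g.

(** The product indicates that all clusters inside [V] are small. Clusters are removed one by one,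
    and as long as many vertices of [V] remain, each removed vertex of [V] gains a factor
    [exp (- a)]. *)
Lemma supercritical_no_big (lam del : R) : 0 < lam -> 0 < del ->
  exists a K : R, 0 < a /\ forall n : nat, K <= n%:R ->
    forall (C : eqType) (s : 'I_n -> C) (c : C),
    let V := colour_class s c in
    del * n%:R < #|V|%:R ->
    cluster_mean (edge_prob (lam / n%:R) s) setT
      (fun S => if S \subset V
                then (small_cluster lam n%:R (#|V|%:R - del * n%:R) #|S|)%:R else 1) <=
    exp (- (a * n%:R)).
Proof.
(* The first factor is the margin [d] used in [cluster_law_down], the second a lower bound for
   [J / n]. *)
move=> lam0 del0; set a := del / 8 * (del / 16).
have a0 : 0 < a by rewrite mulr_gt0 // divr_gt0.
exists (a * (del / 2)), (lam + 16 / del); split; first by rewrite mulr_gt0 // divr_gt0.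
move=> n nK C s c V Vbig.
have d16 : 0 < 16 / del by apply: divr_gt0.
have np : 0 < n%:R :> R by lra.
have p01 : 0 <= lam / n%:R <= 1.
  by apply/andP; split; [apply: divr_ge0; lra | rewrite ler_pdivrMr // mul1r; lra].
have plam : 1 - lam / n%:R <= exp (- (lam / n%:R)) := exp_ge1Dx _.
have deln : 16 <= del * n%:R by rewrite mulrC -ler_pdivrMr //; lra.
set m : R := #|V|%:R in Vbig *; set gl := m - del * n%:R.
have gl0 : 0 < gl by rewrite subr_gt0.
set f := fun S : {set 'I_n} => _.
have f01 S : 0 <= f S <= 1.
  by rewrite /f; case: ifP; case: small_cluster; rewrite ?lexx ?ler01.
have [J /andP[J1 J2]] : exists J : nat, del * n%:R / 8 / 2 <= J%:R <= del * n%:R / 8.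
  by apply: truncn_half; lra.
(* Halfway between [m] and [gl]. Above [mid] a reduction by [J + 1] vertices stays above [gl] with
   margin [del n / 8]; below it the trivial bound 1 suffices. *)
set mid := m - del * n%:R / 2.
suff main U : cluster_mean (edge_prob (lam / n%:R) s) U f <= exp (- (a * (#|U :&: V|%:R - mid))).
  apply: le_trans (main setT) _; rewrite setTI -/m ler_exp // /mid; lra.
move: {2}#|U| (leqnn #|U|) => k; elim: k U => [|k IHk] U Uk.
  move: Uk; rewrite leqn0 cards_eq0 => /eqP ->.
  rewrite cluster_mean0 set0I cards0 -[leLHS]exp0 ler_exp //.
  by rewrite sub0r mulrN opprK mulr_ge0 ?(ltW a0) // /mid; lra.
have [small|large] := leP #|U :&: V|%:R mid.
  apply: (@le_trans _ _ 1); last first.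
    by rewrite -[leLHS]exp0 ler_exp // -mulrN opprB mulr_ge0 ?(ltW a0) ?subr_ge0.
  have := ler_cluster_mean s p01 U f01; rewrite cluster_mean1; exact.
have mid0 : 0 < mid by rewrite /mid; lra.
have [x xUV] : exists x, x \in U :&: V.
  by apply/card_gt0P; rewrite -(ltr_nat R); apply: lt_trans mid0 large.
have /andP[xU xV] : (x \in U) && (x \in V) by rewrite -in_setI.
have sx : s x = c by apply/eqP; move: xV; rewrite inE.
rewrite (cluster_mean_class _ _ _ xU) /= sx -/V; set W := U :&: V in xUV large *.
pose gam i : R := (small_cluster lam n%:R gl i)%:R * exp (a * i%:R).
have mE := cluster_law_sets (lam / n%:R) gam xUV.
apply: (@le_trans _ _ (exp (- (a * (#|W|%:R - mid))) *
    \sum_(j < #|W|) cluster_law (lam / n%:R) #|W|.-1 j * gam j.+1)).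
  rewrite -mE mulr_sumr; apply: ler_sum => S /andP[SW xS].
  have SU : S \subset U by apply: subset_trans SW (subsetIl _ _).
  have SV : S \subset V by apply: subset_trans SW (subsetIr _ _).
  have S0 : (0 < #|S|)%N by apply/card_gt0P; exists x.
  have IH : cluster_mean (edge_prob (lam / n%:R) s) (U :\: S) f <=
      exp (- (a * (#|W|%:R - mid))) * exp (a * #|S|%:R).
    apply: le_trans (IHk _ _) _.
      by rewrite cardsDS // leq_subLR (leq_trans Uk) // -add1n leq_add2r.
    rewrite card_class_setD // -/W natrB ?subset_leq_card // expM.
    by rewrite le_eqVlt; apply/orP; left; apply/eqP/exp_congr; ring.
  rewrite /gam {1}/f SV -/gl; set K := kappa _ _ * _; set b := small_cluster _ _ _ _.
  have -> : exp (- (a * (#|W|%:R - mid))) * (K * (b%:R * exp (a * #|S|%:R))) =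
    K * b%:R * (exp (- (a * (#|W|%:R - mid))) * exp (a * #|S|%:R)) by ring.
  rewrite ler_wpM2l // mulr_ge0 ?ler0n // mulr_ge0 ?kappa_ge0 //.
  by rewrite exprn_ge0 // subr_ge0; case/andP: p01.
rewrite ler_piMr ?exp_ge0 //.
have W0 : (0 < #|W|)%N by apply/card_gt0P; exists x.
have Wn : #|W|%:R <= n%:R :> R by rewrite ler_nat -[leqRHS]card_ord max_card.
have JW : (J <= #|W|.-1)%N.
  by rewrite -ltnS prednK // -(ltr_nat R) (le_lt_trans J2) //; apply: le_lt_trans large; rewrite /mid; lra.
have WJ : #|W|.-1 = (#|W|.-1 - J + J)%N by rewrite subnK.
have W1 : #|W|.-1%:R = #|W|%:R - 1 :> R by rewrite -subn1 natrB.
apply: le_trans (cluster_law_psum p01 (#|W|.-1 - J) #|W|).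
apply: ler_sum => j _; rewrite /gam.
have L0 : 0 <= cluster_law (lam / n%:R) (#|W|.-1 - J) j by apply: cluster_law_ge0.
case: (boolP (small_cluster _ _ _ _)) => [sm|_]; last by rewrite mul0r mulr0.
rewrite mul1r {1}WJ.
have dn0 : 0 < del / 8 by apply: divr_gt0.
have down := cluster_law_down p01 np dn0 plam gl0 _ _ sm.
apply: le_trans (ler_wpM2r (exp_ge0 _) (down (#|W|.-1 - J)%N J _ _)) _.
- rewrite natrB // W1 /gl; move: large; rewrite /mid; lra.
- by rewrite -WJ W1; lra.
rewrite mulrAC expM ler_piMl // exp_le1 // addrC subr_le0.
have -> : del / 8 / n%:R * j.+1%:R * J%:R = (del / 8 * (J%:R / n%:R)) * j.+1%:R by ring.
rewrite ler_wpM2r ?ler0n // /a ler_wpM2l ?(ltW dn0) // ler_pdivlMr //; lra.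
Qed.

(** * Large deviations of a step *)

Lemma expX (t : R) k : exp t ^+ k = exp (t * k%:R).
Proof.
elim: k => [|k IHk]; first by rewrite mulr0 exp0 expr0.
by rewrite exprS IHk expM; apply: exp_congr; rewrite -[k.+1%:R]natr1; ring.
Qed.

(** * Exponential test functions of a colouring *)

Section Probe.
Variables (n q : nat).
Hypothesis q0 : (0 < q)%N.
Implicit Types (B S : {set 'I_n}) (i j : 'I_q) (t : R) (s : config n q).

(** The product over vertices is the indicator that [B] has colour [i], times an exponential of the
    number of vertices of colour [j] outside [B]. This product form is what [sum_color_weight]
    integrates. *)
Definition probe B i j t (x : 'I_n) (c : 'I_q) : R :=
  if x \in B then (c == i)%:R else if c == j then exp t else 1.

Lemma prod_probe B i j t s :
  \prod_x probe B i j t x (s x) =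
  [forall x in B, s x == i]%:R * exp (t * #|colour_class s j :\: B|%:R).
Proof.
rewrite (bigID (fun x => x \in B)) /=; congr (_ * _).
  have [/forall_inP sB|/forall_inPn[x xB sx]] := boolP [forall x in B, s x == i].
    by rewrite big1 // => x xB; rewrite /probe xB sB.
  by apply/eqP/prodf_eq0; exists x => //; rewrite /probe xB (negPf sx).
rewrite -expX -prodr_const (eq_bigr (fun x => if s x == j then exp t else 1)).
  by rewrite -big_mkcondr /=; apply: eq_bigl => x; rewrite !inE.
by move=> x /negPf xB; rewrite /probe xB.
Qed.

Lemma mean_probe_out B S i j t : [disjoint B & S] ->
  q%:R^-1 * \sum_c \prod_(x in S) probe B i j t x c = colour_mgf q t #|S|.
Proof.
move=> dBS; congr (_ * _); rewrite (bigD1 j) //=; congr (_ + _).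
  rewrite -expX -prodr_const; apply: eq_bigr => x xS.
  by rewrite /probe (disjointFl dBS xS) eqxx.
rewrite (eq_bigr (fun=> 1)) => [|c /negPf cj].
  by rewrite sumr_const cardC1 card_ord -subn1 natrB.
by apply: big1 => x xS; rewrite /probe (disjointFl dBS xS) cj.
Qed.

Lemma mean_probe_in B i j t x0 : x0 \in B ->
  q%:R^-1 * \sum_c \prod_(x in B) probe B i j t x c = q%:R^-1 :> R.
Proof.
move=> x0B; rewrite (bigD1 i) //= big1 => [|x xB]; last by rewrite /probe xB eqxx.
rewrite big1 ?addr0 ?mulr1 // => c /negPf ci.
by apply/eqP/prodf_eq0; exists x0 => //; rewrite /probe x0B ci.
Qed.

Lemma color_weight_neq0 (w : edges n) s x y :
  color_weight w s != 0 :> R -> y \in cluster setT w x -> s y = s x.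
Proof.
rewrite color_weightE; case: ifP => [/forallP good _|_]; last by rewrite eqxx.
rewrite inE connect_adj_in_setT => xy.
by have /forallP/(_ y)/implyP/(_ xy)/eqP := good x.
Qed.

Lemma SW_mean (p : R) (s : config n q) (G : config n q -> R) :
  \sum_s' SW p s s' * G s' =
  bern_E (edge_prob p s) (fun w : edges n => \sum_s' color_weight w s' * G s').
Proof.
rewrite bern_E_sum; apply: eq_bigr => s' _.
rewrite [LHS]mulr_suml; apply: eq_bigr => w _.
by rewrite edge_weightE mulrA.
Qed.

Lemma SW_class_mgf (p : R) s j t :
  \sum_s' SW p s s' * exp (t * #|colour_class s' j|%:R) =
  cluster_mean (edge_prob p s) setT (fun S => colour_mgf q t #|S|).
Proof.
rewrite SW_mean; apply: eq_bern_E => w.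
transitivity (\sum_s' color_weight w s' * \prod_x probe set0 j j t x (s' x)).
  apply: eq_bigr => s' _; rewrite prod_probe setD0.
  have -> : [forall x in set0, s' x == j] by apply/forall_inP => x; rewrite inE.
  by rewrite mul1r.
rewrite sum_color_weight //; apply: eq_bigr => C _.
by rewrite mean_probe_out // -setI_eq0 set0I.
Qed.

End Probe.

(** * Chernoff bounds for a step, without and with a giant cluster *)

Section Chernoff.
Variables (n q : nat) (p rho D t0 : R).
Hypothesis q0 : (0 < q)%N.
Hypothesis p01 : 0 <= p <= 1.
Hypothesis D0 : 0 <= D.
Hypothesis mgf : forall (s : config n q) (U : {set 'I_n}) (t : R),
  (forall c, #|U :&: colour_class s c|%:R <= rho * n%:R) -> `|t| <= t0 ->
  cluster_mean (edge_prob p s) U (fun S => colour_mgf q t #|S|) <=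
  exp ((t / q%:R + D * t ^+ 2) * #|U|%:R).

(** Markov's inequality for the exponential of [t] times the size of class [j]. *)
Lemma SW_upper_tail (s : config n q) (j : 'I_q) (t b : R) :
    (forall c, #|colour_class s c|%:R <= rho * n%:R) -> 0 <= t <= t0 ->
  \sum_(s' : config n q | b * n%:R < #|colour_class s' j|%:R) SW p s s' <=
  exp ((t / q%:R + D * t ^+ 2 - t * b) * n%:R).
Proof.
move=> srho /andP[t_ge0 tt0].
have := @mgf s setT t; rewrite -(SW_class_mgf q0 p s j) cardsT card_ord => /(_ _ _) mgfT.
have -> : exp ((t / q%:R + D * t ^+ 2 - t * b) * n%:R) =
    exp ((t / q%:R + D * t ^+ 2) * n%:R) * exp (- (t * b * n%:R)).
  by rewrite expM; apply: exp_congr; ring.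
apply: le_trans (ler_wpM2r (exp_ge0 _) (mgfT _ _)); first last.
- by rewrite ger0_norm.
- by move=> c; rewrite setTI.
rewrite mulr_suml big_mkcond /=; apply: ler_sum => s' _.
case: ifP => [bN|_]; last by rewrite !mulr_ge0 ?exp_ge0 ?SW_ge0.
rewrite -[leRHS]mulrA expM ler_peMr ?SW_ge0 // -[leLHS]exp0 ler_exp //.
rewrite -[t * b * _]mulrA -mulrBr mulr_ge0 // subr_ge0; exact: ltW.
Qed.

Definition ordered (a b : R) (s : config n q) : bool :=
  [exists i : 'I_q, (a * n%:R <= #|colour_class s i|%:R :> R) &&
    [forall j : 'I_q, (j != i) ==> (#|colour_class s j|%:R <= b * n%:R :> R)]].

Variables (s : config n q) (x0 : 'I_n) (big : pred nat) (a b eps x t : R).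
Let V := colour_class s (s x0).
(** A big cluster has density at least [x], and what it leaves of its class has density at most
    [rho], so that [mgf] applies to the rest. *)
Hypothesis bigP : forall k, big k -> (k <= #|V|)%N ->
  x * n%:R <= k%:R /\ (#|V| - k)%:R <= rho * n%:R.
Hypothesis otherP : forall c, c != s x0 -> #|colour_class s c|%:R <= rho * n%:R.
Hypothesis gainP : a + eps <= q%:R^-1 + (1 - q%:R^-1) * x.
Hypothesis bP : b = q%:R^-1 + eps.
Hypothesis tP : 0 <= t <= t0.

(** Factors that force the cluster of [x0] to be [S]: any other cluster containing [x0] contributes
    0, and [q%:R^-1] is the chance that [S] takes a prescribed colour. *)
Let pinned (S : {set 'I_n}) (u : R) (C : {set 'I_n}) : R :=
  if x0 \in C then (if C == S then q%:R^-1 else 0) else colour_mgf q u #|C|.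

Lemma pinned_ge0 S u C : 0 <= pinned S u C.
Proof.
rewrite /pinned; case: ifP => _; last exact: colour_mgf_ge0.
by case: ifP => _; rewrite ?invr_ge0.
Qed.

Lemma sum_probe_cluster (w : edges n) (i j : 'I_q) (u : R) :
  let S := cluster setT w x0 in
  \sum_s' color_weight w s' * \prod_y probe S i j u y (s' y) =
  \prod_(C in clusters setT w) pinned S u C.
Proof.
move=> S; rewrite sum_color_weight //; apply: eq_bigr => C /imsetP[y _ ->].
rewrite /pinned; case: ifP => [xy|xy].
  by rewrite -(eq_cluster xy) -/S eqxx (mean_probe_in _ _ _ (mem_cluster setT w x0)).
rewrite mean_probe_out // -setI_eq0; apply/eqP/setP=> z; rewrite !inE.
apply/negP => /andP[x0z yz]; move/negP: xy; apply; rewrite inE.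
by rewrite (connect_trans yz) // connect_adj_in_sym.
Qed.

(** Union bound over the colour [i] of the cluster: failure means that class [i] is too small or
    that another class [j] is too large, and each case is dominated by an exponential. *)
Lemma disordered_pointwise (w : edges n) (S : {set 'I_n}) : S = cluster setT w x0 ->
  \sum_(s' | ~~ ordered a b s') color_weight w s' <=
  \sum_(i : 'I_q) (exp (- t * (#|S|%:R - a * n%:R)) * \prod_(C in clusters setT w) pinned S (- t) C +
    \sum_(j : 'I_q) exp (- t * (b * n%:R)) * \prod_(C in clusters setT w) pinned S t C).
Proof.
move=> SE.
pose term (i : 'I_q) (s' : config n q) : R :=
  exp (- t * (#|S|%:R - a * n%:R)) * (color_weight w s' * \prod_y probe S i i (- t) y (s' y)) +
  \sum_(j : 'I_q) exp (- t * (b * n%:R)) * (color_weight w s' * \prod_y probe S i j t y (s' y)).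
have probe_ge0 i j u (s' : config n q) : 0 <= \prod_y probe S i j u y (s' y).
  by rewrite prod_probe mulr_ge0 ?ler0n ?exp_ge0.
have cw0 (s' : config n q) : 0 <= color_weight w s' :> R by apply: color_weight_ge0.
have term_ge0 i s' : 0 <= term i s'.
  rewrite addr_ge0 ?mulr_ge0 ?exp_ge0 // sumr_ge0 // => j _.
  by rewrite !mulr_ge0 ?exp_ge0.
apply: (@le_trans _ _ (\sum_s' \sum_i term i s')); last first.
  rewrite exchange_big /=; apply: ler_sum => i _; rewrite big_split /=.
  rewrite -mulr_sumr SE sum_probe_cluster lerD2l exchange_big /=.
  by apply: ler_sum => j _; rewrite -mulr_sumr sum_probe_cluster.
rewrite big_mkcond /=; apply: ler_sum => s' _.
case: ifP => [bad|_]; last by apply: sumr_ge0.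
have [->|cwn0] := eqVneq (color_weight w s' : R) 0; first exact: sumr_ge0.
pose i := s' x0.
have Si y : y \in S -> s' y = i by rewrite SE; apply: color_weight_neq0.
have allS : [forall y in S, s' y == i] by apply/forall_inP => y /Si/eqP.
rewrite (bigD1 i) //= -[leLHS]addr0 lerD ?sumr_ge0 //.
have /andP[t_ge0 _] := tP.
have : (#|colour_class s' i|%:R < a * n%:R) ||
    [exists j : 'I_q, (j != i) && (b * n%:R < #|colour_class s' j|%:R)].
  apply: contraNT bad; rewrite negb_or -leNgt => /andP[ai /existsPn bj].
  apply/existsP; exists i; rewrite ai /=; apply/forallP=> j; apply/implyP=> ji.
  by have := bj j; rewrite ji /= -leNgt.
rewrite /term; case/orP => [Ni|/existsP[j /andP[ji Nj]]].
  apply: ler_wpDr; first by apply: sumr_ge0 => j _; rewrite !mulr_ge0 ?exp_ge0.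
  rewrite prod_probe allS mul1r mulrCA ler_peMr // expM -[leLHS]exp0 ler_exp //.
  rewrite cardsDS; last by apply/subsetP => y /Si sy; rewrite inE sy.
  rewrite natrB; last by apply/subset_leq_card/subsetP => y /Si sy; rewrite inE sy.
  rewrite -mulrDr mulNr -mulrN mulr_ge0 //; lra.
apply: ler_wpDl; first by rewrite !mulr_ge0 ?exp_ge0.
rewrite (bigD1 j) //=; apply: ler_wpDr.
  by apply: sumr_ge0 => j' _; rewrite !mulr_ge0 ?exp_ge0.
rewrite prod_probe allS mul1r mulrCA ler_peMr // expM -[leLHS]exp0 ler_exp //.
have -> : colour_class s' j :\: S = colour_class s' j.
  apply/setDidPl; rewrite disjoints_subset; apply/subsetP => y.
  by rewrite !inE => /eqP sy; apply: contra ji => /Si <-; rewrite sy.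
rewrite mulNr addrC -mulrBr mulr_ge0 // subr_ge0; exact: ltW.
Qed.

(** In the recursion at [x0] only the term of [S] survives, and [mgf] applies to the complement of
    [S]. *)
Lemma pinned_mean (S : {set 'I_n}) (u : R) : x0 \in S -> big #|S| -> `|u| <= t0 ->
  cluster_mean (edge_prob p s) setT (pinned S u) <=
  (S \subset V)%:R * (kappa p #|S| * (1 - p) ^+ (#|S| * (#|V| - #|S|))) * q%:R^-1 *
  exp ((u / q%:R + D * u ^+ 2) * (n%:R - #|S|%:R)).
Proof.
move=> xS bigS ut; rewrite (cluster_mean_class _ _ _ (in_setT x0)) setTI -/V.
case: (boolP (S \subset V)) => [SV|nSV]; last first.
  rewrite big1 ?mul0r // => S' /andP[SV' xS'].
  rewrite /pinned xS'; case: eqP => [eqS|_]; last by rewrite mulr0 mul0r.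
  by rewrite -eqS SV' in nSV.
rewrite (bigD1 S) ?SV //= [X in _ + X]big1 ?addr0; last first.
  by move=> S' /andP[/andP[_ xS'] /negPf neq]; rewrite /pinned xS' neq mulr0 mul0r.
have [xn rest] := bigP bigS (subset_leq_card SV).
have -> : cluster_mean (edge_prob p s) (setT :\: S) (pinned S u) =
    cluster_mean (edge_prob p s) (setT :\: S) (fun C => colour_mgf q u #|C|).
  apply: eq_cluster_mean => C CS; rewrite /pinned ifN //.
  by apply/negP => /(subsetP CS); rewrite inE xS.
have -> : n%:R - #|S|%:R = #|setT :\: S|%:R :> R.
  by rewrite cardsDS ?subsetT // cardsT card_ord natrB // -[leqRHS](card_ord n) max_card.
rewrite mul1r {1}/pinned xS eqxx ler_wpM2l //.
  rewrite mulr_ge0 ?invr_ge0 // mulr_ge0 ?kappa_ge0 //.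
  by rewrite exprn_ge0 // subr_ge0; case/andP: p01.
apply: mgf => // c; have [->|cx] := eqVneq c (s x0).
  by rewrite -/V card_class_setD setTI.
apply: le_trans (otherP cx); rewrite ler_nat subset_leq_card //.
exact: subsetIr.
Qed.

(** Sum over the possible big clusters [S] of [x0]. Their weights add up to at most 1, and for each
    [S] the lower tail of its colour and the upper tails of the colours are Chernoff bounds. *)
Lemma SW_disordered_big :
  bern_E (edge_prob p s) (fun w : edges n => (big #|cluster setT w x0|)%:R *
    \sum_(s' | ~~ ordered a b s') color_weight w s') <=
  (1 + q%:R) * exp ((- t * eps + D * t ^+ 2) * n%:R).
Proof.
have /andP[t_ge0 tt0] := tP.
have qR : 1 <= q%:R :> R by rewrite ler1n.
pose A1 (S : {set 'I_n}) : R := exp (- t * (#|S|%:R - a * n%:R)).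
pose A2 : R := exp (- t * (b * n%:R)).
pose bound (S : {set 'I_n}) (w : edges n) : R :=
  \sum_(i : 'I_q) (A1 S * \prod_(C in clusters setT w) pinned S (- t) C +
    \sum_(j : 'I_q) A2 * \prod_(C in clusters setT w) pinned S t C).
have prod0 S u (w : edges n) : 0 <= \prod_(C in clusters setT w) pinned S u C.
  by apply: prodr_ge0 => C _; apply: pinned_ge0.
have bound0 S w : 0 <= bound S w.
  apply: sumr_ge0 => i _; rewrite addr_ge0 ?mulr_ge0 ?exp_ge0 // sumr_ge0 // => j _.
  by rewrite mulr_ge0 ?exp_ge0.
apply: (@le_trans _ _ (bern_E (edge_prob p s) (fun w : edges n =>
    \sum_(S : {set 'I_n} | (x0 \in S) && big #|S|) bound S w))).
  apply: ler_bern_E => [|w]; first exact: edge_prob01.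
  case: (boolP (big _)) => bigS; last by rewrite mul0r sumr_ge0.
  rewrite mul1r (bigD1 (cluster setT w x0)) /=; last by rewrite mem_cluster.
  rewrite -[leLHS]addr0 lerD ?sumr_ge0 //; exact: disordered_pointwise (erefl _).
rewrite bern_E_sum; set E := exp _.
pose W (S : {set 'I_n}) : R := kappa p #|S| * (1 - p) ^+ (#|S| * (#|V| - #|S|)).
have W0 S : 0 <= W S.
  rewrite mulr_ge0 ?kappa_ge0 // exprn_ge0 // subr_ge0; by case/andP: p01.
apply: (@le_trans _ _ (\sum_(S : {set 'I_n} | (x0 \in S) && big #|S|)
    (S \subset V)%:R * W S * ((1 + q%:R) * E))); last first.
  apply: (@le_trans _ _ (\sum_(S : {set 'I_n} | (S \subset V) && (x0 \in S))
      W S * 1 * ((1 + q%:R) * E))).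
    rewrite [leRHS]big_mkcond [leLHS]big_mkcond /=; apply: ler_sum => S _.
    case: (x0 \in S) => //=; last by rewrite andbF.
    have EE : 0 <= (1 + q%:R) * E by rewrite mulr_ge0 ?exp_ge0 // addr_ge0.
    case: (big _); case: (S \subset V); rewrite ?mul1r ?mulr1 ?mul0r ?lexx //.
    by rewrite mulr_ge0.
  have xV : x0 \in V by rewrite inE.
  rewrite -mulr_suml (cluster_law_sets p (fun=> 1) xV) ler_piMl ?mulr_ge0 ?exp_ge0 ?addr_ge0 //.
  under eq_bigr => j _ do rewrite mulr1.
  exact: cluster_law_psum.
apply: ler_sum => S /andP[xS bigS].
have meanE : bern_E (edge_prob p s) (bound S) =
    q%:R * (A1 S * cluster_mean (edge_prob p s) setT (pinned S (- t)) +
      q%:R * (A2 * cluster_mean (edge_prob p s) setT (pinned S t))).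
  rewrite bern_E_sum sumr_const card_ord -[LHS]mulr_natl; congr (_ * _).
  transitivity (bern_E (edge_prob p s) (fun w : edges n =>
    \sum_(k : bool) if k then A1 S * \prod_(C in clusters setT w) pinned S (- t) C
    else \sum_(j : 'I_q) A2 * \prod_(C in clusters setT w) pinned S t C)).
    by apply: eq_bern_E => w; rewrite big_bool.
  rewrite bern_E_sum big_bool /= bern_EZ; congr (_ + _).
  rewrite bern_E_sum sumr_const card_ord -[LHS]mulr_natl; congr (_ * _).
  by rewrite bern_EZ.
rewrite meanE.
have nt : `|- t| <= t0 by rewrite normrN ger0_norm.
have pt : `|t| <= t0 by rewrite ger0_norm.
have mN := pinned_mean xS bigS nt; have mP := pinned_mean xS bigS pt.
rewrite -/(W S) sqrrN in mN; rewrite -/(W S) in mP.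
case: (boolP (S \subset V)) mN mP => [SV|_]; last first.
  rewrite !mul0r => mN mP.
  have mN0 : A1 S * cluster_mean (edge_prob p s) setT (pinned S (- t)) <= 0.
    by rewrite mulr_ge0_le0 ?exp_ge0.
  have mP0 : A2 * cluster_mean (edge_prob p s) setT (pinned S t) <= 0.
    by rewrite mulr_ge0_le0 ?exp_ge0.
  by nra.
rewrite !mul1r => mN mP.
have [xn _] := bigP bigS (subset_leq_card SV).
set k : R := #|S|%:R in mN mP xn *.
have kn : k <= n%:R by rewrite ler_nat -[leqRHS](card_ord n) max_card.
have k0 : 0 <= k by rewrite ler0n.
set r : R := q%:R^-1 in mN mP *.
have r0 : 0 < r by rewrite invr_gt0; lra.
have r1 : r <= 1 by rewrite invf_le1; lra.
have rq : q%:R * r = 1 by rewrite mulfV //; lra.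
have Dt : D * t ^+ 2 * (n%:R - k) <= D * t ^+ 2 * n%:R.
  by rewrite ler_wpM2l ?mulr_ge0 ?sqr_ge0 //; lra.
have E1 : A1 S * exp ((- t / q%:R + D * t ^+ 2) * (n%:R - k)) <= E.
  rewrite expM ler_exp // -/r -/k.
  (* The mean size of class [i] is [k] plus a fraction [r] of the other vertices; [gainP] puts it
     above the threshold by [eps * n]. *)
  have key : eps * n%:R <= k * (1 - r) + r * n%:R - a * n%:R.
    have h1 : (a + eps) * n%:R <= (r + (1 - r) * x) * n%:R by rewrite ler_wpM2r.
    have h2 : (1 - r) * (x * n%:R) <= (1 - r) * k by rewrite ler_wpM2l //; lra.
    by lra.
  have := ler_wpM2l t_ge0 key; lra.
have E2 : A2 * exp ((t / q%:R + D * t ^+ 2) * (n%:R - k)) <= E.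
  rewrite expM ler_exp // bP -/r.
  have : 0 <= t * (r * k) by rewrite !mulr_ge0 // ltW.
  lra.
have Wr : 0 <= W S * r by rewrite mulr_ge0 // ltW.
have F1 : A1 S * cluster_mean (edge_prob p s) setT (pinned S (- t)) <= W S * r * E.
  apply: le_trans (ler_wpM2l (exp_ge0 _) mN) _.
  by rewrite mulrCA ler_wpM2l.
have F2 : A2 * cluster_mean (edge_prob p s) setT (pinned S t) <= W S * r * E.
  apply: le_trans (ler_wpM2l (exp_ge0 _) mP) _.
  by rewrite mulrCA ler_wpM2l.
(* The chance [r] of a given colour cancels the sum over [i]; one lower tail and [q] upper tails
   remain. *)
have -> : W S * ((1 + q%:R) * E) = q%:R * (W S * r * E + q%:R * (W S * r * E)).
  have -> : q%:R * (W S * r * E + q%:R * (W S * r * E)) = (q%:R * r) * (W S * ((1 + q%:R) * E)) by ring.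
  by rewrite rq mul1r.
have qq : 0 <= q%:R :> R by lra.
by rewrite ler_wpM2l // lerD // ler_wpM2l.
Qed.

End Chernoff.

(** * Two wells *)

Section Mixing.
Variables (T : finType) (P : T -> T -> R) (pi : T -> R).
Hypothesis P0 : forall x y, 0 <= P x y.
Hypothesis P1 : forall x, \sum_y P x y = 1.

Lemma Pt_ge0 t x y : 0 <= Pt P t x y.
Proof.
elim: t y => [|t IHt] y /=; first by case: ifP => _; rewrite ?lexx ?ler01.
by apply: sumr_ge0 => z _; apply: mulr_ge0.
Qed.

Lemma Pt_sum1 t x : \sum_y Pt P t x y = 1.
Proof.
elim: t => [|t IHt] /=.
  rewrite (bigD1 x) //= eqxx big1 ?addr0 // => y /negPf.
  by rewrite eq_sym => ->.
rewrite /rsum exchange_big -[RHS]IHt; apply: eq_bigr => z _.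
by rewrite -mulr_sumr P1 mulr1.
Qed.

(** Union bound over the time of the first exit. *)
Lemma Pt_escape (A : {set T}) e t x : 0 <= e ->
    {in A, forall y, \sum_(z | z \notin A) P y z <= e} -> x \in A ->
  \sum_(y | y \notin A) Pt P t x y <= t%:R * e.
Proof.
move=> e0 stick xA; elim: t => [|t IHt].
  rewrite mul0r big1 // => y yA /=.
  by case: eqP => // xy; rewrite -xy xA in yA.
rewrite /= /rsum exchange_big /= (bigID (fun z => z \in A)) /=.
rewrite -[t.+1%:R]natr1 mulrDl mul1r addrC lerD //.
  apply: le_trans IHt; apply: ler_sum => z _.
  rewrite -mulr_sumr ler_piMr ?Pt_ge0 // -(P1 z) [leRHS](bigID (fun y => y \notin A)) /=.
  by rewrite lerDl sumr_ge0.
apply: (@le_trans _ _ (\sum_(z in A) Pt P t x z * e)).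
  by apply: ler_sum => z zA; rewrite -mulr_sumr ler_wpM2l ?Pt_ge0 // stick.
rewrite -mulr_suml ler_piMl // -(Pt_sum1 t x) [leRHS](bigID (fun y => y \in A)) /=.
by rewrite lerDl sumr_ge0 // => *; apply: Pt_ge0.
Qed.

Lemma rmax_ge (I : finType) (G : I -> R) i : G i <= rmax G.
Proof.
rewrite /rmax unlock; have := mem_index_enum i; elim: (index_enum I) => //= j r IHr.
rewrite inE RmaxE le_max => /orP[/eqP <-|/IHr ->]; rewrite ?lexx ?orbT //.
Qed.

(** From [x] the set [A] has mass at least [1 - t e], from [y] at most [t e]. Both are within
    [1 / (2 exp 1)], hence within 1/4, of [pi] of [A]. *)
Lemma two_wells (A B : {set T}) e t x y : 0 <= e ->
    {in A, forall z, \sum_(z' | z' \notin A) P z z' <= e} ->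
    {in B, forall z, \sum_(z' | z' \notin B) P z z' <= e} ->
    [disjoint A & B] -> x \in A -> y \in B ->
    is_mixed P pi t ->
  1 <= 4 * (t%:R * e).
Proof.
move=> e0 stickA stickB dAB xA yB /RltP mixed.
have dist z : `|rmeas (Pt P t z) A - rmeas pi A| < (2 * exp 1)^-1.
  apply: le_lt_trans mixed; apply: le_trans (rmax_ge _ z).
  by apply: le_trans (rmax_ge _ A); rewrite RabsE.
have rmeasE nu : rmeas nu A = \sum_(z in A) nu z by [].
have := dist x; have := dist y; rewrite !ltr_norml !rmeasE.
move=> /andP[y1 y2] /andP[x1 x2].
have e2 : (2 * exp 1)^-1 <= 4^-1 :> R.
  by rewrite lef_pV2 ?posrE ?mulr_gt0 ?exp_gt0 //; have := exp_ge1Dx 1; lra.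
have hx := Pt_escape t e0 stickA xA; have hy := Pt_escape t e0 stickB yB.
have sx : \sum_(z in A) Pt P t x z = 1 - \sum_(z | z \notin A) Pt P t x z.
  by rewrite -(Pt_sum1 t x) [in RHS](bigID (fun z => z \in A)) /= addrK.
have sy : \sum_(z in A) Pt P t y z <= \sum_(z | z \notin B) Pt P t y z.
  rewrite big_mkcond [leRHS]big_mkcond /=; apply: ler_sum => z _.
  case: ifP => [zA|_]; first by rewrite (disjointFr dAB zA).
  by case: ifP => _ //; apply: Pt_ge0.
lra.
Qed.

End Mixing.

(** Colours are given to consecutive blocks of length [L]; inside a block the residue modulo [L]
    determines the vertex. *)
Lemma balanced_config n q : (0 < q)%N ->
  exists s : config n q, forall c, (#|colour_class s c| <= (n %/ q).+1)%N.
Proof.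
move=> q0; set L := (n %/ q).+1.
have ltq (x : 'I_n) : (x %/ L < q)%N.
  rewrite ltn_divLR // (leq_trans (ltn_ord x)) // /L mulnS.
  by rewrite {1}(divn_eq n q) mulnC addnC leq_add2r ltnW // ltn_pmod.
exists [ffun x => Ordinal (ltq x)] => c; rewrite -[leqRHS]card_ord.
pose f (x : 'I_n) : 'I_L := inord (x %% L).
apply: (@leq_card_in _ _ f) => x y; rewrite !inE !ffunE => /eqP xc /eqP yc.
move=> /(congr1 val); rewrite /= !inordK ?ltn_pmod // => xy; apply/val_inj => /=.
rewrite (divn_eq x L) (divn_eq y L) xy; congr (_ * _ + _)%N.
by have := congr1 val (etrans xc (esym yc)).
Qed.

(* At [z] with [fs q z < lam] a majority colour of density [G], the density
   whose giant component has density [z / lam], is on average enlarged by a step. *)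
Lemma metastable_constants (q : nat) (lam z : R) :
    (3 <= q)%N -> 0 < z -> z + q%:R * z / (exp z - 1) < lam -> lam < q%:R ->
  exists x G eps rho : R,
  [/\ [/\ x = z / lam, 0 < x, x < 1 & G * (1 - exp (- z)) = x],
      [/\ 0 < eps, lam^-1 <= G & G + eps + eps <= q%:R^-1 + (1 - q%:R^-1) * x],
      q%:R^-1 + eps < lam^-1 &
      [/\ 0 < rho, lam * rho < 1, q%:R^-1 + eps <= rho & eps + (lam * (1 + z / 4))^-1 <= rho]].
Proof.
move=> q3 z0 fz lamq.
have qR : 3 <= q%:R :> R by rewrite ler_nat.
have ez : z < exp z - 1.
  have h := exp_ge1Dx (z / 2); have : exp z = exp (z / 2) * exp (z / 2).
    by rewrite expM; apply: exp_congr; field.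
  by nra.
have y0 : 0 < z / (exp z - 1) by apply: divr_gt0; lra.
have zlam : z < lam by rewrite -mulrA in fz; nra.
have lam0 : 0 < lam by lra.
set x := z / lam; have x0 : 0 < x by apply: divr_gt0.
have x1 : x < 1 by rewrite ltr_pdivrMr // mul1r.
set E := exp (- z); have EE : E * exp z = 1 by rewrite expM -exp0; apply: exp_congr; ring.
have E0 : 0 < E by apply: exp_gt0.
have E1 : E < 1 by nra.
(* The equation of the giant component: in a class of density [G] it has density [x], with
   [lam * x = z]. *)
set G := x / (1 - E).
have GE : G = x + x / (exp z - 1).
  rewrite /G; have -> : E = (exp z)^-1 by apply: (mulIf (lt0r_neq0 (exp_gt0 z))); rewrite EE mulVf ?lt0r_neq0 ?exp_gt0.
  by field; apply/andP; split; [|have := exp_gt0 z]; lra.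
set r : R := q%:R^-1.
have r0 : 0 < r by rewrite invr_gt0; lra.
have rq : r * q%:R = 1 by rewrite mulVf //; lra.
have rlam : r < lam^-1 by rewrite ltf_pV2 ?posrE //; lra.
(* The gain of a step equals [(lam - fs q z) / (q * lam)]. *)
have gap : 0 < r + (1 - r) * x - G.
  have lx : lam * x = z by rewrite /x mulrC divfK //; lra.
  have h : 0 < (lam * r) * (r + (1 - r) * x - G) * q%:R.
    have -> : (lam * r) * (r + (1 - r) * x - G) * q%:R =
       (r * q%:R) * (r * lam - r * (lam * x) - lam * x / (exp z - 1)) by rewrite GE; ring.
    rewrite rq mul1r lx.
    have : 0 < r * (lam - (z + q%:R * z / (exp z - 1))) by rewrite mulr_gt0 // subr_gt0.
    have -> : r * (lam - (z + q%:R * z / (exp z - 1))) =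
      r * lam - r * z - (r * q%:R) * (z / (exp z - 1)) by ring.
    by rewrite rq mul1r.
  move: h; rewrite pmulr_lgt0; last by lra.
  by rewrite pmulr_rgt0 // mulr_gt0.
set l := lam^-1 in rlam *; have l0 : 0 < l by rewrite invr_gt0.
have ll : lam * l = 1 by rewrite mulfV //; lra.
set u := (1 + z / 4)^-1.
have u1 : u < 1 by rewrite invf_lt1; lra.
have u0 : 0 < u by rewrite invr_gt0; lra.
have G1 : l <= G.
  rewrite ler_pdivlMr; last by lra.
  rewrite /x [z / _]mulrC ler_pM2l //; have := exp_ge1Dx (- z); rewrite -/E; lra.
(* The bounds keep, in turn, the gain of a step, the density [r + eps] below [1 / lam], and the
   remainder of a class without its giant cluster subcritical. *)
pose eps := Num.min ((r + (1 - r) * x - G) / 2) (Num.min ((l - r) / 2) (l * (1 - u) / 2)).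
have e0 : 0 < eps.
  rewrite !lt_min !divr_gt0 // ?subr_gt0 //; last by rewrite mulr_gt0 // subr_gt0.
have [e1 e2 e3] : [/\ eps <= (r + (1 - r) * x - G) / 2, eps <= (l - r) / 2 &
    eps <= l * (1 - u) / 2].
  by have := lexx eps; rewrite {2}/eps !le_min => /and3P[].
exists x, G, eps, (Num.max (r + eps) (eps + (lam * (1 + z / 4))^-1)).
rewrite !invfM -/l -/u; split.
- by split=> //; rewrite -/E divfK //; lra.
- by split=> //; lra.
- by lra.
split; rewrite ?le_max ?lexx ?orbT //.
  by rewrite lt_max; apply/orP; left; lra.
rewrite maxr_pMr ?ltW // gt_max; apply/andP; split.
  have : lam * (r + eps) < lam * l by rewrite ltr_pM2l //; lra.
  by rewrite ll.
have lu : l * u < l by rewrite gtr_pMr.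
have : lam * (eps + l * u) < lam * l by rewrite ltr_pM2l //; lra.
by rewrite ll.
Qed.

(** By [exp_chord] every size below [z / lam * n] is small, which gives the lower bound. The upper
    bound is the duality principle: a cluster that is not small leaves fewer than
    [exp (- y) * g + eps * n] vertices, where [y = lam * k / n]. *)
Lemma giant_cluster (lam z n G eps rho m k : R) :
    0 < n -> 0 < lam -> 0 < z -> 0 < G -> G * (1 - exp (- z)) = z / lam -> 0 < eps ->
    (G + eps) * n <= m -> eps + (lam * (1 + z / 4))^-1 <= rho -> 0 <= k ->
    ~~ (exp (- (lam * k / n)) <= 1 - k / (m - eps * n)) ->
  z / lam * n <= k /\ m - k <= rho * n.
Proof.
move=> n0 lam0 z0 G0 Gz eps0 Gm rhoP k0; rewrite -ltNge => notsmall.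
set g := m - eps * n in notsmall *.
have gG : G * n <= g by rewrite /g; lra.
have Gn : 0 < G * n by apply: mulr_gt0.
have g0 : 0 < g by lra.
have x0 : 0 < z / lam by apply: divr_gt0.
have kx : z / lam * n <= k.
  rewrite leNgt; apply/negP => kx; move: notsmall; apply/negP; rewrite -leNgt.
  pose r := k / (z / lam * n).
  have r01 : 0 <= r <= 1.
    have xn : 0 < z / lam * n by apply: mulr_gt0.
    by rewrite divr_ge0 ?(ltW xn) //= ler_pdivrMr // mul1r ltW.
  have -> : lam * k / n = r * z by rewrite /r; field; lra.
  apply: (le_trans (exp_chord z r01)); rewrite lerD2l lerN2.
  have -> : 1 - exp (- z) = z / lam / G by rewrite -Gz; field; lra.
  have -> : r * (z / lam / G) = k / (G * n) by rewrite /r; field; lra.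
  by rewrite ler_wpM2l // lef_pV2.
split=> //.
set y := lam * k / n in notsmall.
have yk : k = y * n / lam by rewrite /y; field; lra.
have yz : z <= y.
  rewrite /y ler_pdivlMr //; have := ler_wpM2l (ltW lam0) kx.
  by have -> : lam * (z / lam * n) = z * n by field; lra.
set e := exp (- y) in notsmall.
have ey : e * exp y = 1 by rewrite expM -exp0; apply: exp_congr; ring.
have e0 : 0 < e by apply: exp_gt0.
have h1 : (1 - e) * g < k.
  have : (1 - k / g) * g < e * g by rewrite ltr_pM2r.
  rewrite mulrBl mul1r divfK ?lt0r_neq0 //; lra.
(* Follows from [exp y >= (1 + y / 2)^2] and [y >= z]; the excess [z / 4] is what makes the
   remainder strictly subcritical. *)
have h2 : 1 + y * (1 + z / 4) <= exp y.
  have -> : exp y = exp (y / 2) * exp (y / 2) by rewrite expM; apply: exp_congr; field.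
  have h := exp_ge1Dx (y / 2).
  have : (1 + y / 2) * (1 + y / 2) <= exp (y / 2) * exp (y / 2) by apply: ler_pM => //; lra.
  have : y * z <= y * y by rewrite ler_wpM2l //; lra.
  lra.
set v := 1 + z / 4 in rhoP h2; have v0 : 0 < v by rewrite /v; lra.
have h3 : e * (y * v) <= 1 - e.
  have : e * (1 + y * v) <= e * exp y by rewrite ler_pM2l.
  by rewrite ey mulrDr mulr1; lra.
have h4 : y * (e * v * g * lam) <= y * n.
  have : e * (y * v) * g <= (1 - e) * g by rewrite ler_pM2r.
  have : k * lam = y * n by rewrite yk; field; lra.
  have lk : (1 - e) * g * lam <= k * lam by rewrite ler_pM2r // ltW.
  move=> <- h; apply: le_trans lk.
  have -> : y * (e * v * g * lam) = e * (y * v) * g * lam by ring.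
  by rewrite ler_pM2r.
have h5 : e * g <= n * (lam * v)^-1.
  rewrite ler_pdivlMr ?mulr_gt0 //.
  move: h4; rewrite ler_pM2l; last by lra.
  by have -> : e * v * g * lam = e * g * (lam * v) by ring.
have : (eps + (lam * v)^-1) * n <= rho * n by rewrite ler_pM2r.
have -> : m = g + eps * n by rewrite /g; ring.
lra.
Qed.

Lemma exp_dominates (c B : R) : 0 < c -> 0 <= B ->
  exists K : R, forall n : R, K <= n -> 4 * (B * n * exp (- (c * n))) <= exp (- (c / 2 * n)).
Proof.
move=> c0 B0; exists (64 * B / c ^+ 2 + 1) => n nK.
have cc : 0 < c ^+ 2 by rewrite exprn_gt0.
have q0 : 0 <= 64 * B / c ^+ 2 by rewrite divr_ge0 ?mulr_ge0 // ltW.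
have n0 : 0 < n by lra.
have nB : 64 * B <= n * c ^+ 2 by rewrite -ler_pdivrMr //; lra.
have h := @exp_sqr_le (c / 2 * n).
have h' : (c / 2 * n) ^+ 2 <= 4 * exp (c / 2 * n).
  by apply: h; rewrite mulr_ge0 ?divr_ge0 ?ltW.
have -> : exp (- (c * n)) = exp (- (c / 2 * n)) * exp (- (c / 2 * n)).
  by rewrite expM; apply: exp_congr; field.
have E1 : exp (c / 2 * n) * exp (- (c / 2 * n)) = 1.
  by rewrite expM -exp0; apply: exp_congr; ring.
have E0 := exp_gt0 (- (c / 2 * n)); set e := exp (- _) in E1 E0 *.
have -> : 4 * (B * n * (e * e)) = (4 * B * n * e) * e by ring.
rewrite ler_piMl ?(ltW E0) //.
apply: (@le_trans _ _ (exp (c / 2 * n) * e)); last by rewrite E1.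
rewrite ler_pM2r //.
have : 64 * B * n <= n * c ^+ 2 * n by rewrite ler_pM2r.
have -> : n * c ^+ 2 * n = 4 * (c / 2 * n) ^+ 2 by field.
lra.
Qed.

(** * Exit probabilities of the two wells *)

Section Wells.
Variables (n q : nat) (lam z G eps rho D t0 t alpha : R).
Let p : R := lam / n%:R.
Let a : R := G + eps.
Let b : R := q%:R^-1 + eps.
Hypothesis q0 : (0 < q)%N.
Hypothesis n0 : 0 < n%:R :> R.
Hypothesis p01 : 0 <= p <= 1.
Hypothesis D0 : 0 <= D.
Hypothesis tP : 0 <= t <= t0.
Hypothesis brho : b <= rho.
Hypothesis mgf : forall (s : config n q) (U : {set 'I_n}) (u : R),
  (forall c, #|U :&: colour_class s c|%:R <= rho * n%:R) -> `|u| <= t0 ->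
  cluster_mean (edge_prob p s) U (fun S => colour_mgf q u #|S|) <=
  exp ((u / q%:R + D * u ^+ 2) * #|U|%:R).

Definition disordered_well : {set config n q} :=
  [set s : config n q | [forall j : 'I_q, #|colour_class s j|%:R <= b * n%:R :> R]].

Definition ordered_well : {set config n q} := [set s : config n q | ordered a b s].

(** All classes are subcritical, so this is a union bound over the upper tails of the [q]
    colours. *)
Lemma disordered_sticky s : s \in disordered_well ->
  \sum_(s' | s' \notin disordered_well) SW p s s' <=
  q%:R * exp ((- t * eps + D * t ^+ 2) * n%:R).
Proof.
rewrite inE => /forallP sb.
apply: (@le_trans _ _ (\sum_(j : 'I_q) \sum_(s' : config n q | b * n%:R < #|colour_class s' j|%:R)
    SW p s s')).
  have -> : \sum_(j : 'I_q) \sum_(s' : config n q | b * n%:R < #|colour_class s' j|%:R) SW p s s' =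
      \sum_(s' : config n q) \sum_(j : 'I_q | b * n%:R < #|colour_class s' j|%:R) SW p s s'.
    rewrite (exchange_big_dep predT) //=; by apply: eq_bigr.
  rewrite big_mkcond /=; apply: ler_sum => s' _.
  have SW0 : 0 <= SW p s s' by apply: SW_ge0.
  case: ifP => [|_]; last by apply: sumr_ge0.
  rewrite inE negb_forall => /existsP[j]; rewrite -ltNge => bj.
  by rewrite (bigD1 j) //= lerDl sumr_ge0.
have -> : q%:R * exp ((- t * eps + D * t ^+ 2) * n%:R) =
    \sum_(j : 'I_q) exp ((- t * eps + D * t ^+ 2) * n%:R).
  by rewrite sumr_const card_ord mulr_natl.
apply: ler_sum => j _; apply: le_trans (SW_upper_tail q0 p01 mgf j b _ tP) _.
  by move=> c; apply: le_trans (sb c) _; rewrite ler_pM2r.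
by rewrite le_eqVlt; apply/orP; left; apply/eqP/exp_congr; rewrite /b; ring.
Qed.

Hypothesis lam0 : 0 < lam.
Hypothesis z0 : 0 < z.
Hypothesis G0 : 0 < G.
Hypothesis Gz : G * (1 - exp (- z)) = z / lam.
Hypothesis eps0 : 0 < eps.
Hypothesis gain : a + eps <= q%:R^-1 + (1 - q%:R^-1) * (z / lam).
Hypothesis rhoP : eps + (lam * (1 + z / 4))^-1 <= rho.
Hypothesis nobig : forall (s : config n q) c, let V := colour_class s c in
  eps * n%:R < #|V|%:R ->
  cluster_mean (edge_prob p s) setT
    (fun S => if S \subset V
              then (small_cluster lam n%:R (#|V|%:R - eps * n%:R) #|S|)%:R else 1) <=
  exp (- (alpha * n%:R)).

(** Either the majority class has no big cluster, or one of its at most [n] vertices lies in a big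
    cluster and the next state still fails to be ordered. *)
Lemma ordered_sticky s : s \in ordered_well ->
  \sum_(s' | s' \notin ordered_well) SW p s s' <=
  exp (- (alpha * n%:R)) + n%:R * ((1 + q%:R) * exp ((- t * eps + D * t ^+ 2) * n%:R)).
Proof.
rewrite inE => /existsP[i /andP[ai /forallP bj]].
set V := colour_class s i; set m : R := #|V|%:R.
have Vbig : eps * n%:R < m.
  by apply: lt_le_trans ai; rewrite ltr_pM2r // /a ltrDr.
pose small k := small_cluster lam n%:R (m - eps * n%:R) k.
pose f (w : edges n) : R := \sum_(s' : config n q | ~~ ordered a b s') color_weight w s'.
have -> : \sum_(s' | s' \notin ordered_well) SW p s s' = bern_E (edge_prob p s) f.
  by rewrite SW_event; apply: eq_bern_E => w; apply: eq_bigl => s'; rewrite inE.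
pose nob (w : edges n) : R := \prod_(C in clusters setT w)
  (if C \subset V then (small #|C|)%:R else 1).
have f0 w : 0 <= f w by apply: sumr_ge0 => s' _; apply: color_weight_ge0.
have f1 w : f w <= 1.
  rewrite -(sum_color_weight1 q0 w) /f [leRHS](bigID (fun s' => ~~ ordered a b s')) /=.
  by rewrite lerDl sumr_ge0 // => s' _; apply: color_weight_ge0.
have nob0 w : 0 <= nob w.
  by apply: prodr_ge0 => C _; case: ifP.
(* Union bound indexed by [option]: [None] stands for the absence of a big cluster, [Some x0] for a
   big cluster at [x0]. *)
apply: (@le_trans _ _ (bern_E (edge_prob p s) (fun w : edges n =>
    \sum_(o : option 'I_n | if o is Some x0 then x0 \in V else true)
      if o is Some x0 then (~~ small #|cluster setT w x0|)%:R * f w else nob w))).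
  apply: ler_bern_E => [|w]; first exact: edge_prob01.
  rewrite (bigD1 None) //=.
  have rest0 (Q : pred (option 'I_n)) : 0 <= \sum_(o : option 'I_n | Q o)
      if o is Some x0 then (~~ small #|cluster setT w x0|)%:R * f w else nob w.
    by apply: sumr_ge0 => -[x0|] _ //; rewrite mulr_ge0.
  have [/forall_inP allsmall|/forall_inPn[x0 x0V bigx0]] :=
    boolP [forall x0 in V, small #|cluster setT w x0|].
    apply: ler_wpDr; first exact: rest0.
    rewrite /nob big1; first exact: f1.
    move=> C /imsetP[y _ ->]; case: ifP => // /subsetP CV.
    by rewrite allsmall // CV // mem_cluster.
  apply: ler_wpDl => //; rewrite (bigD1 (Some x0)) /=; last by rewrite x0V.
  by apply: ler_wpDr => //; rewrite bigx0 mul1r.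
rewrite bern_E_sum (bigD1 None) //= lerD //; first exact: nobig.
apply: (@le_trans _ _ (\sum_(o : option 'I_n | (if o is Some x0 then x0 \in V else true) && (o != None))
    (1 + q%:R) * exp ((- t * eps + D * t ^+ 2) * n%:R))).
  apply: ler_sum => -[x0|] /andP[] // x0V _.
  have sx : s x0 = i by apply/eqP; move: x0V; rewrite inE.
  apply: (@SW_disordered_big n q p rho D t0 q0 p01 D0 mgf s x0 (fun k => ~~ small k) a b eps
    (z / lam) t) => //.
  - move=> k bigk kV; rewrite sx -/V in kV *.
    have [k1 k2] := giant_cluster n0 lam0 z0 G0 Gz eps0 ai rhoP (ler0n _ k) bigk.
    by rewrite natrB.
  - move=> c; rewrite sx => ci; have /implyP/(_ ci) := bj c.
    by move=> cb; apply: le_trans cb _; rewrite ler_pM2r.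
rewrite sumr_const -[leLHS]mulr_natl ler_wpM2r //.
  by rewrite mulr_ge0 ?exp_ge0 // addr_ge0.
rewrite ler_nat; apply: leq_trans (_ : #|[set~ None : option 'I_n]| <= n)%N.
  by apply/subset_leq_card/subsetP => o; rewrite !inE => /andP[].
by rewrite cardsC1 card_option card_ord.
Qed.

Lemma wells_disjoint : lam^-1 <= G -> b < lam^-1 -> [disjoint disordered_well & ordered_well].
Proof.
move=> Gl bl; rewrite disjoints_subset; apply/subsetP => s; rewrite !inE => /forallP sb.
apply/existsPn => i; rewrite negb_and -ltNge; apply/orP; left.
apply: le_lt_trans (sb i) _; rewrite ltr_pM2r //.
by apply: lt_trans bl _; apply: le_lt_trans Gl _; rewrite /a ltrDl.
Qed.

Lemma ordered_well_ne : a <= 1 -> exists s, s \in ordered_well.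
Proof.
move=> a1; pose c0 : 'I_q := Ordinal q0.
exists [ffun=> c0]; rewrite inE; apply/existsP; exists c0; apply/andP; split.
  have -> : colour_class [ffun=> c0] c0 = [set: 'I_n] by apply/setP=> x; rewrite !inE ffunE eqxx.
  by rewrite cardsT card_ord ler_piMl ?ler0n.
apply/forallP => j; apply/implyP => jc.
have -> : colour_class [ffun=> c0] j = set0 :> {set 'I_n}.
  by apply/setP=> x; rewrite !inE ffunE eq_sym (negPf jc).
by rewrite cards0 mulr_ge0 ?ler0n // addr_ge0 ?invr_ge0 // ltW.
Qed.

Lemma disordered_well_ne : 1 <= eps * n%:R -> exists s, s \in disordered_well.
Proof.
move=> n1; have [s sP] := balanced_config n q0.
exists s; rewrite inE; apply/forallP => j.
apply: (@le_trans _ _ ((n %/ q).+1)%:R); first by rewrite ler_nat.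
rewrite -natr1 /b mulrDl lerD // mulrC ler_pdivlMr ?ltr0n //.
by rewrite -natrM ler_nat leq_trunc_div.
Qed.

End Wells.

(** * Lower bound on the mixing time *)

Lemma slow_mixing (q : nat) (lam z : R) :
    (3 <= q)%N -> 0 < z -> z + q%:R * z / (exp z - 1) < lam -> lam < q%:R ->
  exists c : R, 0 < c /\ exists N : nat, forall n : nat, (N <= n)%N ->
    forall (pi : config n q -> R) (t : nat),
    is_mixed (SW (lam / n%:R)) pi t -> exp (c * n%:R) <= t%:R.
Proof.
move=> q3 z0 fz lamq.
have [x [G [eps [rho [[xE x0 x1 Gx] [eps0 Gl gain] bl [rho0 sub brho rhoP]]]]]] :=
  metastable_constants q3 z0 fz lamq.
have q0 : (0 < q)%N by apply: leq_trans q3.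
have qR : 3 <= q%:R :> R by rewrite ler_nat.
have r0 : 0 < q%:R^-1 :> R by rewrite invr_gt0; lra.
have lam0 : 0 < lam by rewrite -invr_gt0; lra.
have l0 : 0 < lam^-1 by rewrite invr_gt0.
have G0 : 0 < G by lra.
have Gz : G * (1 - exp (- z)) = z / lam by rewrite Gx.
have [D [t0 [K1 [D0 t00 mgf]]]] := subcritical_mgf lam0 rho0 sub.
have [alpha [K2 [alpha0 nobig]]] := supercritical_no_big lam0 eps0.
(* Makes [D t^2] at most half of [t eps], so that the Chernoff exponent is at most [- t eps / 2]. *)
pose t := Num.min t0 (eps / (2 * D)).
have t_gt0 : 0 < t by rewrite lt_min t00 divr_gt0 // mulr_gt0.
have tP : 0 <= t <= t0 by rewrite ltW //= ge_min lexx.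
have tD : D * t <= eps / 2.
  have : t <= eps / (2 * D) by rewrite ge_min lexx orbT.
  rewrite ler_pdivlMr ?mulr_gt0 //; lra.
pose c := Num.min alpha (t * eps / 2).
have c0 : 0 < c by rewrite lt_min alpha0 divr_gt0 // mulr_gt0.
have ca : c <= alpha by rewrite ge_min lexx.
have ct : - t * eps + D * t ^+ 2 <= - c.
  have : c <= t * eps / 2 by rewrite ge_min lexx orbT.
  have := ler_wpM2l (ltW t_gt0) tD; lra.
(* With this constant [B * n * E] dominates both exit bounds. *)
pose B : R := 2 * (1 + q%:R).
have B0 : 0 <= B by rewrite mulr_ge0 // addr_ge0.
have [K3 dom] := exp_dominates c0 B0.
exists (c / 2); split; first by apply: divr_gt0.
(* [K3] absorbs the factor [4 B n], [lam + 1] gives [n >= 1] and an edge probability at most 1, and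
   [eps^-1] leaves room for rounding in the balanced colouring. *)
pose K := Num.max (Num.max K1 K2) (Num.max K3 (Num.max (lam + 1) eps^-1)).
exists (Num.truncn K).+1 => n Kn; have : K <= n%:R.
  by apply: le_trans (ltW (truncnS_gt K)) _; rewrite ler_nat.
rewrite !ge_max => /andP[/andP[nK1 nK2] /and3P[nK3 nlam neps]] pi T mixed.
have n0 : 0 < n%:R :> R by lra.
have n1 : 1 <= n%:R :> R by lra.
have p01 : 0 <= lam / n%:R <= 1.
  by apply/andP; split; [apply: divr_ge0; lra | rewrite ler_pdivrMr // mul1r; lra].
have mgfn (s : config n q) (U : {set 'I_n}) (u : R) Us ut := mgf n nK1 _ s U q u q0 Us ut.
have nobign (s : config n q) i := nobig n nK2 _ s i.
set E := exp (- (c * n%:R)); have E0 : 0 <= E by apply: exp_ge0.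
have Et : exp ((- t * eps + D * t ^+ 2) * n%:R) <= E.
  by apply: ler_exp; rewrite -mulNr ler_pM2r.
have Ea : exp (- (alpha * n%:R)) <= E.
  by apply: ler_exp; rewrite lerN2 ler_pM2r.
set e := B * n%:R * E; have e0 : 0 <= e by rewrite !mulr_ge0 ?ler0n // addr_ge0.
have nE : E <= n%:R * E by rewrite ler_peMl.
have nqE : 0 <= q%:R * (n%:R * E) by rewrite !mulr_ge0 ?ler0n.
have [s0 s0P] : exists s, s \in disordered_well n q eps.
  apply: disordered_well_ne => //.
  by rewrite -(ler_pM2l (x := eps^-1)) ?invr_gt0 // mulr1 mulKf // lt0r_neq0.
have [s1 s1P] : exists s, s \in ordered_well n q G eps.
  apply: ordered_well_ne => //; have : (1 - q%:R^-1) * x <= (1 - q%:R^-1) * 1 :> R.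
    by rewrite ler_wpM2l ?(ltW x1) // subr_ge0 invf_le1; lra.
  lra.
have gain' : G + eps + eps <= q%:R^-1 + (1 - q%:R^-1) * (z / lam) by rewrite -xE.
have stick0 : {in disordered_well n q eps, forall s,
    \sum_(s' | s' \notin disordered_well n q eps) SW (lam / n%:R) s s' <= e}.
  move=> s sP; apply: le_trans (disordered_sticky q0 n0 p01 tP brho mgfn sP) _.
  apply: (@le_trans _ _ (q%:R * E)); first by rewrite ler_wpM2l.
  have : q%:R * E <= q%:R * (n%:R * E) by rewrite ler_wpM2l.
  rewrite /e /B; lra.
have stick1 : {in ordered_well n q G eps, forall s,
    \sum_(s' | s' \notin ordered_well n q G eps) SW (lam / n%:R) s s' <= e}.
  move=> s sP; apply: le_trans (ordered_sticky q0 n0 p01 (ltW D0) tP brho mgfn lam0 z0 G0 Gz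
    eps0 gain' rhoP nobign sP) _.
  have : n%:R * ((1 + q%:R) * exp ((- t * eps + D * t ^+ 2) * n%:R)) <=
      n%:R * ((1 + q%:R) * E).
    by rewrite ler_wpM2l // ler_wpM2l // addr_ge0.
  rewrite /e /B; lra.
have := two_wells (SW_ge0 p01) (SW_sum1 q0 (lam / n%:R)) e0 stick0 stick1
  (wells_disjoint n0 eps0 Gl bl) s0P s1P mixed.
have := dom n%:R nK3; rewrite -/E -/e => dome low.
have : 1 <= T%:R * exp (- (c / 2 * n%:R)).
  apply: (le_trans low); have -> : 4 * (T%:R * e) = T%:R * (4 * e) by ring.
  by rewrite ler_wpM2l.
have Ec : exp (c / 2 * n%:R) * exp (- (c / 2 * n%:R)) = 1.
  by rewrite expM -exp0; apply: exp_congr; ring.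
by rewrite -{1}Ec ler_pM2r ?exp_gt0.
Qed.

Delimit Scope R_scope with R.
Bind Scope R_scope with R.
Arguments exp _%_R_scope.
Close Scope ring_scope.

Theorem theorem1 (q : nat) (Hq : (3 <= q)%N) (lam ls : R)
  (Hls : is_lambda_s q ls) (Hlam : (ls < lam < INR q)%R) :
  exists c : R, (0 < c)%R /\
    exists N : nat, forall n : nat, (N <= n)%N ->
      forall t : nat,
        is_mixed (SW (n:=n) (q:=q) (lam / INR n)) (potts (n:=n) (q:=q) (beta_of n lam)) t ->
        (exp (c * INR n) <= INR t)%R.
Proof.
case: Hls => _ [z [z_ge0 fz]]; case: Hlam => /RltP; rewrite -{}fz => fz /RltP.
rewrite INRE => lamq; move: fz; rewrite /fs.
(* At 0 the value of [fs] is [q], which exceeds [lam]; hence the minimum is attained at a positive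
   [z]. *)
destruct (RIneq.Req_EM_T z 0) as [z_eq0|z_neq0]; rewrite /= INRE.
  by move=> /(lt_trans lamq); rewrite ltxx.
rewrite RdivE => fz.
have /RltP z_gt0 : (0 < z)%R by case: z_ge0 => // /esym.
have [c [/RltP c0 [N slow]]] := slow_mixing Hq z_gt0 fz lamq.
exists c; split=> //; exists N => n Nn t; rewrite RdivE !INRE => mixed.
by apply/RleP; apply: slow mixed.
Qed.
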